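(* There is an absolute constant $C>0$ such that the following holds. Let $n\ge 1$, let $f:\{0,1\}^n\times\{0,1\}^n\to\{0,1\}$, and let $\mu$ be a product distribution on $\{0,1\}^n\times\{0,1\}^n$. Then $$\mathsf{CC}^\mu_{0.49}(f)\le C\left(\mathsf{IC}_{1/8}(f)\cdot\log \mathsf{IC}_{1/8}(f)\right)^2 + C$$ and $$\mathsf{CC}^\mu_{0.49}(f)\le C\left(\log \mathsf{prt}_{1/8}(f)\cdot\log\log \mathsf{prt}_{1/8}(f)\right)^2 + C.$$
   Context: Two-party communication model: Alice gets $x\in\mathcal X$, Bob gets $y\in\mathcal Y$. A distribution $\mu$ on $\mathcal X\times\mathcal Y$ is a product distribution if $\mu(x,y)=\mu_X(x)\mu_Y(y)$ for distributions $\mu_X,\mu_Y$. $\mathsf{CC}^\mu_\epsilon(f)$ (distributional communication complexity) is the minimum, over deterministic protocols computing $f$ with error probability at most $\epsilon$ when $(x,y)\sim\mu$, of the worst-case number of bits communicated. A rectangle is a set $A\times B$ with $A\subseteq\mathcal X$, $B\subseteq \mathcal Y$. All logarithms are base 2. Information complexity: for a randomized (public-coin) protocol $\Pi$ and distribution $\mu$ on inputs, with $(X,Y)\sim\mu$ and $T_\Pi$ the transcript including public randomness, $\mathsf{IC}^\mu(\Pi)=I[X:T_\Pi\mid Y]+I[Y:T_\Pi\mid X]$. $\mathsf{IC}^\mu_\epsilon(f)=\min_\Pi \mathsf{IC}^\mu(\Pi)$ over protocols computing $f$ with error at most $\epsilon$ under $\mu$, and $\mathsf{IC}_\epsilon(f)=\max_\mu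 \mathsf{IC}^\mu_\epsilon(f)$. Partition bound: for $f:\mathcal X\times\mathcal Y\to\mathcal Z$ and $\epsilon\in(0,1)$, $\mathsf{prt}_\epsilon(f)$ is the optimal value of the LP: minimize $\sum_{z\in\mathcal Z}\sum_R w_{z,R}$ (over all rectangles $R$) subject to $\sum_{R\ni(x,y)} w_{f(x,y),R}\ge 1-\epsilon$ for all $(x,y)$; $\sum_{R\ni(x,y)}\sum_z w_{z,R}=1$ for all $(x,y)$; $w_{z,R}\ge 0$. *)

(* Defs.v *)
From Stdlib Require Import Reals List Bool.
Import ListNotations.
Open Scope R_scope.

Definition sumL {T : Type} (l : list T) (f : T -> R) : R :=
  fold_right Rplus 0 (map f l).

Definition log2 (x : R) : R := ln x / ln 2.

Fixpoint bits (n : nat) : list (list bool) :=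
  match n with
  | O => [[]]
  | S m => map (cons false) (bits m) ++ map (cons true) (bits m)
  end.

Definition input := list bool.

Definition is_dist1 (n : nat) (p : input -> R) : Prop :=
  (forall x, 0 <= p x) /\ sumL (bits n) p = 1.

Definition is_dist2 (n : nat) (mu : input -> input -> R) : Prop :=
  (forall x y, 0 <= mu x y) /\
  sumL (bits n) (fun x => sumL (bits n) (fun y => mu x y)) = 1.

Definition bool_err (a b : bool) : R := if Bool.eqb a b then 0 else 1.

Inductive dtree : Type :=
| DLeaf : bool -> dtree
| DA : (input -> bool) -> dtree -> dtree -> dtree
| DB : (input -> bool) -> dtree -> dtree -> dtree.

Fixpoint dcost (t : dtree) : nat :=
  match t with
  | DLeaf _ => O
  | DA _ t0 t1 | DB _ t0 t1 => S (Nat.max (dcost t0) (dcost t1))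
  end.

Fixpoint deval (t : dtree) (x y : input) : bool :=
  match t with
  | DLeaf z => z
  | DA g t0 t1 => if g x then deval t1 x y else deval t0 x y
  | DB g t0 t1 => if g y then deval t1 x y else deval t0 x y
  end.

Definition derror (n : nat) (mu : input -> input -> R)
  (f : input -> input -> bool) (t : dtree) : R :=
  sumL (bits n) (fun x => sumL (bits n) (fun y =>
    mu x y * bool_err (deval t x y) (f x y))).

(* CC^mu_eps(f) <= b  (CC is a minimum over protocols of the worst-case cost) *)
Definition CC_le (n : nat) (mu : input -> input -> R) (eps : R)
  (f : input -> input -> bool) (b : R) : Prop :=
  exists t : dtree, derror n mu f t <= eps /\ INR (dcost t) <= b.

(* A private-coin protocol tree: at an Alice node she sends bit 1 with
   probability p x (fresh private coin; depends on her input and, through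
   the node, on the history); similarly for Bob. Leaves carry the output. *)
Inductive ptree : Type :=
| PLeaf : bool -> ptree
| PA : (input -> R) -> ptree -> ptree -> ptree
| PB : (input -> R) -> ptree -> ptree -> ptree.

Fixpoint valid_ptree (t : ptree) : Prop :=
  match t with
  | PLeaf _ => True
  | PA p t0 t1 | PB p t0 t1 =>
      (forall u, 0 <= p u <= 1) /\ valid_ptree t0 /\ valid_ptree t1
  end.

Fixpoint leaves (t : ptree) : list (list bool * bool) :=
  match t with
  | PLeaf z => [([], z)]
  | PA _ t0 t1 | PB _ t0 t1 =>
      map (fun pz => (false :: fst pz, snd pz)) (leaves t0) ++
      map (fun pz => (true :: fst pz, snd pz)) (leaves t1)
  end.

Fixpoint tprob (t : ptree) (x y : input) (path : list bool) : R :=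
  match t, path with
  | PLeaf _, [] => 1
  | PA p t0 _, false :: rest => (1 - p x) * tprob t0 x y rest
  | PA p _ t1, true :: rest => p x * tprob t1 x y rest
  | PB q t0 _, false :: rest => (1 - q y) * tprob t0 x y rest
  | PB q _ t1, true :: rest => q y * tprob t1 x y rest
  | _, _ => 0
  end.

(* public-coin protocol: public randomness i drawn with probability w_i,
   then private-coin protocol tree_i is run. *)
Definition rprot := list (R * ptree).

Definition valid_rprot (P : rprot) : Prop :=
  (forall wt, In wt P -> 0 <= fst wt /\ valid_ptree (snd wt)) /\
  sumL P fst = 1.

Definition indexed (P : rprot) : list (nat * (R * ptree)) :=
  combine (seq 0 (length P)) P.

(* transcripts including the public randomness: (i, path) *)
Definition transcripts (P : rprot) : list (nat * list bool) :=
  flat_map (fun iw => map (fun pz => (fst iw, fst pz)) (leaves (snd (snd iw))))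
           (indexed P).

Definition rerror (n : nat) (mu : input -> input -> R)
  (f : input -> input -> bool) (P : rprot) : R :=
  sumL (bits n) (fun x => sumL (bits n) (fun y =>
    mu x y * sumL P (fun wt =>
      fst wt * sumL (leaves (snd wt)) (fun pz =>
        tprob (snd wt) x y (fst pz) * bool_err (snd pz) (f x y))))).

Definition joint (mu : input -> input -> R) (P : rprot)
  (x y : input) (tr : nat * list bool) : R :=
  let wt := nth (fst tr) P (0, PLeaf false) in
  mu x y * fst wt * tprob (snd wt) x y (snd tr).

(* conditional mutual information I[A : C | B] for a joint law Pj a b c
   on finite supports la, lb, lc (with 0 log 0 = 0) *)
Definition cond_MI {A B C : Type} (la : list A) (lb : list B) (lc : list C)
  (Pj : A -> B -> C -> R) : R :=
  sumL la (fun a => sumL lb (fun b => sumL lc (fun c =>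
    let p := Pj a b c in
    let pb := sumL la (fun a' => sumL lc (fun c' => Pj a' b c')) in
    let pab := sumL lc (fun c' => Pj a b c') in
    let pbc := sumL la (fun a' => Pj a' b c) in
    if Req_EM_T p 0 then 0 else p * log2 (p * pb / (pab * pbc))))).

Definition IC_mu (n : nat) (mu : input -> input -> R) (P : rprot) : R :=
  cond_MI (bits n) (bits n) (transcripts P) (fun x y t => joint mu P x y t) +
  cond_MI (bits n) (bits n) (transcripts P) (fun y x t => joint mu P x y t).

Definition is_glb (S : R -> Prop) (m : R) : Prop :=
  (forall s, S s -> m <= s) /\ (forall m', (forall s, S s -> m' <= s) -> m' <= m).

Definition is_IC_mu (n : nat) (mu : input -> input -> R) (eps : R)
  (f : input -> input -> bool) (I : R) : Prop :=
  is_glb (fun v => exists P, valid_rprot P /\ rerror n mu f P <= eps /\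
                             v = IC_mu n mu P) I.

Definition is_IC (n : nat) (eps : R) (f : input -> input -> bool) (I : R) : Prop :=
  is_lub (fun v => exists mu, is_dist2 n mu /\ is_IC_mu n mu eps f v) I.

Fixpoint powerset {T : Type} (l : list T) : list (list T) :=
  match l with
  | [] => [[]]
  | a :: l' => powerset l' ++ map (cons a) (powerset l')
  end.

Definition memb (x : input) (A : list input) : bool :=
  if in_dec (list_eq_dec bool_dec) x A then true else false.

Definition rect := (list input * list input)%type.

Definition rects (n : nat) : list rect :=
  list_prod (powerset (bits n)) (powerset (bits n)).

Definition in_rect (x y : input) (Rc : rect) : bool :=
  memb x (fst Rc) && memb y (snd Rc).

Definition prt_feasible (n : nat) (eps : R) (f : input -> input -> bool)
  (w : bool -> rect -> R) : Prop :=
  (forall z Rc, 0 <= w z Rc) /\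
  (forall x y, In x (bits n) -> In y (bits n) ->
     sumL (rects n) (fun Rc => if in_rect x y Rc then w (f x y) Rc else 0)
       >= 1 - eps /\
     sumL (rects n) (fun Rc =>
       if in_rect x y Rc then sumL [false; true] (fun z => w z Rc) else 0) = 1).

Definition prt_obj (n : nat) (w : bool -> rect -> R) : R :=
  sumL [false; true] (fun z => sumL (rects n) (fun Rc => w z Rc)).

Definition is_prt (n : nat) (eps : R) (f : input -> input -> bool) (p : R) : Prop :=
  (exists w, prt_feasible n eps f w /\ prt_obj n w = p) /\
  (forall w, prt_feasible n eps f w -> p <= prt_obj n w).

(* Main.v *)
(* Run on product inputs, a low-information protocol, or the partition read as the
   channel that names a random rectangle containing the input, is a channel whose
   messages have probabilities [u x * v y]; let [info] be the mutual information
   between inputs and message, at most [K].  If the announced output has small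
   variance under the current product law, the majority output errs only about
   three times as often as the channel.  Otherwise two independent messages
   announcing different outputs meet less often than their marginals predict.  Since
   the law is a product, this depletion is due to one of the two sides: reweighting
   one player's input by some message announcing [true] lowers the weight of the
   messages announcing [false].  Ask that player whether the input lies in the
   (fuzzy) set given by this reweighting.  The question lowers [info] by a constant
   times the probability of the answer [true], which is at least [exp (- O(K))].
   Hence there are O(K) answers [true] on average, among exp (O(K)) questions, and
   each can be located by a binary search with O(K) bits.  This gives O(K^2) bits,
   without logarithmic factor. *)

Require Import Defs.
From Stdlib Require Import Reals List Bool Lra Lia Psatz ZArith Classical.
Import ListNotations.
Open Scope R_scope.

(** * Finite sums and relative entropy *)

Lemma sumL_cons {T : Type} (a : T) (l : list T) (f : T -> R) :
  sumL (a :: l) f = f a + sumL l f.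
Proof. reflexivity. Qed.

Lemma sumL_ext {T : Type} (l : list T) (f g : T -> R) :
  (forall a, In a l -> f a = g a) -> sumL l f = sumL l g.
Proof.
  induction l as [|a l IH]; intros H; [reflexivity|].
  rewrite !sumL_cons, (H a), IH; [reflexivity| |left; reflexivity].
  intros b Hb; apply H; right; exact Hb.
Qed.

Lemma sumL_le {T : Type} (l : list T) (f g : T -> R) :
  (forall a, In a l -> f a <= g a) -> sumL l f <= sumL l g.
Proof.
  induction l as [|a l IH]; intros H; [apply Rle_refl|].
  rewrite !sumL_cons; apply Rplus_le_compat; [apply H; left; reflexivity|].
  apply IH; intros b Hb; apply H; right; exact Hb.
Qed.

Lemma sumL_0 {T : Type} (l : list T) : sumL l (fun _ => 0) = 0.
Proof. induction l as [|a l IH]; [reflexivity|rewrite sumL_cons, IH; lra]. Qed.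

Lemma sumL_nonneg {T : Type} (l : list T) (f : T -> R) :
  (forall a, In a l -> 0 <= f a) -> 0 <= sumL l f.
Proof. intros H; rewrite <- (sumL_0 l); apply sumL_le; exact H. Qed.

Lemma sumL_plus {T : Type} (l : list T) (f g : T -> R) :
  sumL l (fun a => f a + g a) = sumL l f + sumL l g.
Proof. induction l as [|a l IH]; [unfold sumL; simpl; lra|rewrite !sumL_cons, IH; lra]. Qed.

Lemma sumL_scal {T : Type} (l : list T) (c : R) (f : T -> R) :
  sumL l (fun a => c * f a) = c * sumL l f.
Proof. induction l as [|a l IH]; [unfold sumL; simpl; lra|rewrite !sumL_cons, IH; lra]. Qed.

Lemma sumL_scalr {T : Type} (l : list T) (c : R) (f : T -> R) :
  sumL l (fun a => f a * c) = sumL l f * c.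
Proof. induction l as [|a l IH]; [unfold sumL; simpl; lra|rewrite !sumL_cons, IH; lra]. Qed.

Lemma sumL_minus {T : Type} (l : list T) (f g : T -> R) :
  sumL l (fun a => f a - g a) = sumL l f - sumL l g.
Proof. induction l as [|a l IH]; [unfold sumL; simpl; lra|rewrite !sumL_cons, IH; lra]. Qed.

Lemma sumL_app {T : Type} (l1 l2 : list T) (f : T -> R) :
  sumL (l1 ++ l2) f = sumL l1 f + sumL l2 f.
Proof.
  induction l1 as [|a l IH]; [unfold sumL; simpl; lra|].
  rewrite <- app_comm_cons, !sumL_cons, IH; lra.
Qed.

Lemma sumL_map {S T : Type} (h : S -> T) (l : list S) (f : T -> R) :
  sumL (map h l) f = sumL l (fun s => f (h s)).
Proof. unfold sumL; rewrite map_map; reflexivity. Qed.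

Lemma sumL_flat_map {S T : Type} (h : S -> list T) (l : list S) (f : T -> R) :
  sumL (flat_map h l) f = sumL l (fun s => sumL (h s) f).
Proof.
  induction l as [|a l IH]; [reflexivity|].
  cbn [flat_map]; rewrite sumL_app, sumL_cons, IH; reflexivity.
Qed.

Lemma sumL_swap {S T : Type} (l : list S) (m : list T) (f : S -> T -> R) :
  sumL l (fun a => sumL m (fun b => f a b)) =
  sumL m (fun b => sumL l (fun a => f a b)).
Proof.
  induction l as [|a l IH].
  - cbn; symmetry; apply sumL_0.
  - rewrite sumL_cons, IH, <- sumL_plus; apply sumL_ext; intros b _.
    rewrite sumL_cons; reflexivity.
Qed.

Lemma sumL_prod {S T : Type} (l : list S) (m : list T) (f : S -> R) (g : T -> R) :
  sumL l (fun a => sumL m (fun b => f a * g b)) = sumL l f * sumL m g.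
Proof.
  rewrite <- sumL_scalr; apply sumL_ext; intros a _; apply sumL_scal.
Qed.

Lemma sumL_pos_exists {T : Type} (l : list T) (f : T -> R) :
  0 < sumL l f -> exists a, In a l /\ 0 < f a.
Proof.
  induction l as [|a l IH]; [unfold sumL; simpl; lra|]; rewrite sumL_cons; intros H.
  destruct (Rlt_le_dec 0 (f a)) as [Ha|Ha]; [exists a; split; [left|]; easy|].
  destruct IH as [b [Hb Hf]]; [lra|]; exists b; split; [right|]; easy.
Qed.

Lemma sumL_ge_term {T : Type} (l : list T) (f : T -> R) (a : T) :
  (forall b, In b l -> 0 <= f b) -> In a l -> f a <= sumL l f.
Proof.
  induction l as [|b l IH]; intros H Ha; [easy|]; rewrite sumL_cons.
  assert (0 <= f b) by (apply H; left; reflexivity).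
  assert (H' : forall c, In c l -> 0 <= f c) by (intros c Hc; apply H; right; exact Hc).
  destruct Ha as [->|Ha].
  - pose proof (sumL_nonneg l f H'); lra.
  - specialize (IH H' Ha); lra.
Qed.

Lemma sumL_if {T : Type} (l : list T) (b : bool) (f : T -> R) :
  sumL l (fun a => if b then f a else 0) = if b then sumL l f else 0.
Proof. destruct b; [reflexivity|apply sumL_0]. Qed.

(** * Tangent bounds for the logarithm *)

Lemma ln_ge_1_sub_inv (t : R) : 0 < t -> 1 - / t <= ln t.
Proof.
  intros Ht; destruct (Req_dec (ln t) 0) as [E|E].
  - assert (t = 1) by (apply ln_inv; [exact Ht|lra|rewrite E, ln_1; reflexivity]).
    subst; rewrite ln_1; lra.
  - assert (1 + - ln t < exp (- ln t)) by (apply exp_ineq1; lra).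
    rewrite exp_Ropp, exp_ln in H by exact Ht; lra.
Qed.

Lemma ln_le_sub_1 (t : R) : 0 < t -> ln t <= t - 1.
Proof.
  intros Ht; pose proof (ln_ge_1_sub_inv (/ t) (Rinv_0_lt_compat _ Ht)) as H.
  rewrite ln_Rinv, Rinv_inv in H by exact Ht; lra.
Qed.

(** Multiply [1 - / t <= ln t] at [t = x / y] by [x]. The implication is absolute continuity: at
    [y = 0] both sides vanish. *)
Lemma xlnx_ge (x y : R) :
  0 <= x -> 0 <= y -> (y = 0 -> x = 0) -> x - y <= x * ln (x / y).
Proof.
  intros Hx Hy H.
  destruct (Req_dec x 0) as [->|Nx]; [lra|].
  assert (0 < y) by (destruct (Req_dec y 0); [tauto|lra]).
  pose proof (ln_ge_1_sub_inv (x / y) ltac:(apply Rdiv_lt_0_compat; lra)) as L.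
  apply Rle_trans with (x * (1 - / (x / y))).
  - right; field; lra.
  - apply Rmult_le_compat_l; lra.
Qed.

(* Linearised lower bound for the gap in [xlnx_ge]: the tangent of
   [x ln (x/y)] at [x = y / (1 + l)]. *)
Lemma xlnx_ge_gap (x y l : R) :
  0 <= x -> 0 <= y -> 0 <= l -> (y = 0 -> x = 0) ->
  x - y + (l * (y - x) - l ^ 2 * y) <= x * ln (x / y).
Proof.
  intros Hx Hy Hl H.
  assert (Hs : y * / (1 + l) <= y * (1 - l + l ^ 2)).
  { apply Rmult_le_compat_l; [lra|].
    apply Rmult_le_reg_l with (1 + l); [lra|].
    rewrite Rinv_r by lra; nra. }
  destruct (Req_dec x 0) as [->|Nx].
  { pose proof (Rle_0_sqr (1 - l)); assert (0 < / (1 + l)) by (apply Rinv_0_lt_compat; lra).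
    nra. }
  assert (0 < y) by (destruct (Req_dec y 0); [tauto|lra]).
  assert (E : x / y = (x * (1 + l) / y) * / (1 + l)) by (field; lra).
  assert (0 < x * (1 + l) / y) by (apply Rdiv_lt_0_compat; nra).
  rewrite E, ln_mult, ln_Rinv by first [assumption | lra | apply Rinv_0_lt_compat; lra].
  pose proof (ln_ge_1_sub_inv (x * (1 + l) / y) ltac:(assumption)) as L1.
  pose proof (ln_le_sub_1 (1 + l) ltac:(lra)) as L2.
  apply Rle_trans with (x * (1 - / (x * (1 + l) / y) - l)).
  - replace (x * (1 - / (x * (1 + l) / y) - l)) with (x - y * / (1 + l) - l * x) by (field; lra).
    lra.
  - apply Rmult_le_compat_l; lra.
Qed.

(** * Relative entropy of a reweighted law *)

Definition mass {T : Type} (X : list T) (p : T -> R) : R := sumL X p.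

Definition dot {T : Type} (X : list T) (p u : T -> R) : R :=
  sumL X (fun x => p x * u x).

(* [dot X p u] times the relative entropy of the law proportional to [p u]
   with respect to the law proportional to [p]. *)
Definition ent {T : Type} (X : list T) (p u : T -> R) : R :=
  sumL X (fun x => p x * u x * ln (u x * mass X p / dot X p u)).

Lemma mass_nonneg {T : Type} (X : list T) (p : T -> R) :
  (forall x, 0 <= p x) -> 0 <= mass X p.
Proof. intros H; apply sumL_nonneg; auto. Qed.

Lemma dot_nonneg {T : Type} (X : list T) (p u : T -> R) :
  (forall x, 0 <= p x) -> (forall x, 0 <= u x) -> 0 <= dot X p u.
Proof. intros Hp Hu; apply sumL_nonneg; intros x _; apply Rmult_le_pos; auto. Qed.

Lemma dot_plus_l {T : Type} (X : list T) (p1 p0 u : T -> R) :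
  dot X (fun x => p1 x + p0 x) u = dot X p1 u + dot X p0 u.
Proof.
  unfold dot; rewrite <- sumL_plus; apply sumL_ext; intros; ring.
Qed.

Lemma dot_ge_term {T : Type} (X : list T) (p u : T -> R) (x : T) :
  (forall x, 0 <= p x) -> (forall x, 0 <= u x) -> In x X -> p x * u x <= dot X p u.
Proof.
  intros Hp Hu Hx.
  apply (sumL_ge_term X (fun x => p x * u x)); [|exact Hx].
  intros y _; apply Rmult_le_pos; auto.
Qed.

(** With [c = dot X p u / mass X p], the mean of [u], this is [p x] times [u ln (u / c) - u + c], so
    [xlnx_ge] applies. *)
Lemma ent_term_ge {T : Type} (X : list T) (p u : T -> R) (x : T) :
  (forall x, 0 <= p x) -> (forall x, 0 <= u x) -> 0 < mass X p -> In x X ->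
  0 <= p x * u x * ln (u x * mass X p / dot X p u) - p x * u x + p x * (dot X p u / mass X p).
Proof.
  intros Hp Hu HP Hx.
  pose proof (dot_nonneg X p u Hp Hu) as Ha.
  pose proof (dot_ge_term X p u x Hp Hu Hx) as Hax.
  pose proof (Hp x); pose proof (Hu x).
  destruct (Req_dec (dot X p u) 0) as [E|E].
  - assert (E0 : p x * u x = 0) by (pose proof (Rmult_le_pos _ _ (Hp x) (Hu x)); lra).
    rewrite E0, E; unfold Rdiv; rewrite !Rmult_0_l; lra.
  - assert (0 < dot X p u) by lra.
    destruct (Req_dec (p x) 0) as [E0|E0]; [rewrite E0; lra|].
    assert (0 <= dot X p u / mass X p) by (apply Rle_mult_inv_pos; lra).
    assert (0 < dot X p u / mass X p) by (apply Rdiv_lt_0_compat; lra).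
    pose proof (xlnx_ge (u x) (dot X p u / mass X p) ltac:(lra) ltac:(lra) ltac:(lra)) as K.
    replace (u x / (dot X p u / mass X p)) with (u x * mass X p / dot X p u) in K
      by (field; lra).
    replace (p x * u x * ln (u x * mass X p / dot X p u) - p x * u x
             + p x * (dot X p u / mass X p))
      with (p x * (u x * ln (u x * mass X p / dot X p u) -
                   (u x - dot X p u / mass X p))) by ring.
    apply Rmult_le_pos; lra.
Qed.

(** The two added terms both sum to [dot X p u] and cancel. By [ent_term_ge] the entropy is now a
    sum of nonnegative terms, which can be estimated pointwise. *)
Lemma ent_centered {T : Type} (X : list T) (p u : T -> R) :
  0 < mass X p ->
  ent X p u = sumL X (fun x => p x * u x * ln (u x * mass X p / dot X p u) - p x * u x
                               + p x * (dot X p u / mass X p)).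
Proof.
  intros HP; rewrite sumL_plus, sumL_minus, sumL_scalr.
  fold (mass X p); unfold ent; fold (dot X p u).
  replace (sumL X (fun x => p x * u x)) with (dot X p u) by reflexivity.
  field; lra.
Qed.

Lemma mass0_zero {T : Type} (X : list T) (p : T -> R) (x : T) :
  (forall x, 0 <= p x) -> mass X p <= 0 -> In x X -> p x = 0.
Proof.
  intros Hp H Hx; pose proof (sumL_ge_term X p x (fun y _ => Hp y) Hx).
  unfold mass in H; pose proof (Hp x); lra.
Qed.

Lemma ent_nonneg {T : Type} (X : list T) (p u : T -> R) :
  (forall x, 0 <= p x) -> (forall x, 0 <= u x) -> 0 <= ent X p u.
Proof.
  intros Hp Hu; destruct (Rlt_le_dec 0 (mass X p)) as [HP|HP].
  - rewrite ent_centered by exact HP; apply sumL_nonneg; intros x Hx.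
    apply ent_term_ge; assumption.
  - right; symmetry; unfold ent; rewrite <- (sumL_0 X); apply sumL_ext; intros x Hx.
    rewrite (mass0_zero X p x Hp HP Hx); ring.
Qed.

(** A Markov argument: where [u] exceeds [L] times its mean, the centered summand is at least
    [(ln L - 1) * p x * u x], hence pays for the part cut off; elsewhere nothing is cut off. *)
Lemma ent_truncation {T : Type} (X : list T) (p u : T -> R) (L : R) :
  (forall x, 0 <= p x) -> (forall x, 0 <= u x) -> 0 < mass X p -> 0 < L -> 1 < ln L ->
  dot X p u - dot X p (fun x => Rmin (u x) (L * dot X p u / mass X p))
    <= ent X p u / (ln L - 1).
Proof.
  intros Hp Hu HP HL0 HL.
  apply Rmult_le_reg_r with (ln L - 1); [lra|].
  replace (ent X p u / (ln L - 1) * (ln L - 1)) with (ent X p u) by (field; lra).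
  unfold dot at 1 2; rewrite <- sumL_minus, <- sumL_scalr, ent_centered by exact HP.
  apply sumL_le; intros x Hx.
  pose proof (ent_term_ge X p u x Hp Hu HP Hx) as Hpos.
  pose proof (dot_nonneg X p u Hp Hu) as Ha.
  pose proof (dot_ge_term X p u x Hp Hu Hx) as Hax.
  pose proof (Hp x) as Hpx; pose proof (Hu x) as Hux.
  set (a := dot X p u) in *; set (P := mass X p) in *.
  destruct (Rle_dec (u x) (L * a / P)) as [Hle|Hgt].
  - rewrite Rmin_left by exact Hle; lra.
  - rewrite Rmin_right by lra.
    destruct (Req_dec a 0) as [E|E].
    + assert (p x * u x = 0) by (pose proof (Rmult_le_pos _ _ Hpx Hux); lra).
      rewrite E in *; replace (L * 0 / P) with 0 by (field; lra).
      replace (p x * u x - p x * 0) with 0 by lra. lra.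
    + assert (0 < a) by lra.
      assert (Hlt : L * a / P < u x) by lra.
      assert (0 <= L * a / P) by (apply Rle_mult_inv_pos; nra).
      assert (0 <= a / P) by (apply Rle_mult_inv_pos; lra).
      assert (HlnL : ln L <= ln (u x * P / a)).
      { left; apply ln_increasing; [exact HL0|].
        apply Rmult_lt_reg_r with (a / P); [apply Rdiv_lt_0_compat; lra|].
        replace (u x * P / a * (a / P)) with (u x) by (field; lra).
        unfold Rdiv in *; lra. }
      assert (p x * u x * ln L <= p x * u x * ln (u x * P / a))
        by (apply Rmult_le_compat_l; [apply Rmult_le_pos|]; assumption).
      assert (0 <= p x * (a / P)) by (apply Rmult_le_pos; assumption).
      assert (0 <= p x * (L * a / P) * (ln L - 1))
        by (apply Rmult_le_pos; [apply Rmult_le_pos|lra]; assumption).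
      nra.
Qed.

(** Normalising by [p1] instead of [p] shifts every logarithm by the same constant, the log-ratio of
    the actual weight [dot X p1 u] to the weight expected from [mass X p1]. *)
Lemma ent_part {T : Type} (X : list T) (p p1 u : T -> R) :
  (forall x, 0 <= p1 x <= p x) -> (forall x, 0 <= u x) ->
  sumL X (fun x => p1 x * u x * ln (u x * mass X p / dot X p u)) =
  ent X p1 u + dot X p1 u * ln (dot X p1 u / (dot X p u * mass X p1 / mass X p)).
Proof.
  intros Hp Hu.
  unfold dot at 2; rewrite <- sumL_scalr; unfold ent; rewrite <- sumL_plus.
  apply sumL_ext; intros x Hx.
  destruct (Req_dec (p1 x * u x) 0) as [E|E]; [rewrite E; ring|].
  assert (Hp1 : forall x, 0 <= p1 x) by (intros z; apply Hp).
  assert (Hp' : forall x, 0 <= p x) by (intros z; pose proof (Hp z); lra).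
  pose proof (Hp1 x); pose proof (Hu x); pose proof (Hp x).
  assert (0 < p1 x * u x) by (pose proof (Rmult_le_pos (p1 x) (u x)); lra).
  assert (0 < u x) by nra. assert (0 < p1 x) by nra.
  pose proof (dot_ge_term X p1 u x Hp1 Hu Hx).
  pose proof (dot_ge_term X p u x Hp' Hu Hx).
  pose proof (sumL_ge_term X p1 x (fun y _ => Hp1 y) Hx) as M1; fold (mass X p1) in M1.
  pose proof (sumL_ge_term X p x (fun y _ => Hp' y) Hx) as M0; fold (mass X p) in M0.
  assert (p1 x * u x <= p x * u x) by (apply Rmult_le_compat_r; lra).
  assert (0 < dot X p1 u) by lra. assert (0 < dot X p u) by lra.
  rewrite <- Rmult_plus_distr_l; f_equal.
  rewrite <- ln_mult.
  - f_equal; field; repeat split; lra.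
  - apply Rdiv_lt_0_compat; [apply Rmult_lt_0_compat|]; lra.
  - apply Rdiv_lt_0_compat; [lra|apply Rdiv_lt_0_compat; [apply Rmult_lt_0_compat|]; lra].
Qed.

(** By [ent_part] the entropy lost is the divergence of the actual weights of the two parts from the
    expected ones, [y] being that of [p1]. Both pairs have the same total, so the linear terms of
    the tangent bounds cancel and the gap for [p1] remains. *)
Lemma ent_split {T : Type} (X : list T) (p p1 p0 u : T -> R) (l : R) :
  (forall x, p x = p1 x + p0 x) ->
  (forall x, 0 <= p1 x) -> (forall x, 0 <= p0 x) -> (forall x, 0 <= u x) ->
  0 < mass X p -> 0 <= l ->
  let y := dot X p u * mass X p1 / mass X p in
  ent X p1 u + ent X p0 u + (l * Rmax 0 (y - dot X p1 u) - l ^ 2 * y) <= ent X p u.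
Proof.
  intros E H1 H0 Hu HP Hl y.
  assert (Hp : forall x, 0 <= p x)
    by (intros x; rewrite E; pose proof (H1 x); pose proof (H0 x); lra).
  assert (EM : mass X p = mass X p1 + mass X p0).
  { unfold mass; rewrite <- sumL_plus; apply sumL_ext; intros; apply E. }
  assert (ED : dot X p u = dot X p1 u + dot X p0 u).
  { rewrite <- dot_plus_l; apply sumL_ext; intros; rewrite E; reflexivity. }
  assert (EE : ent X p u =
    sumL X (fun x => p1 x * u x * ln (u x * mass X p / dot X p u)) +
    sumL X (fun x => p0 x * u x * ln (u x * mass X p / dot X p u))).
  { rewrite <- sumL_plus; apply sumL_ext; intros x _; rewrite (E x) at 1; ring. }
  rewrite (ent_part X p p1 u), (ent_part X p p0 u) in EE
    by first [exact Hu | intros x; rewrite E; pose proof (H1 x); pose proof (H0 x); lra].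
  fold y in EE.
  pose proof (mass_nonneg X p1 H1); pose proof (mass_nonneg X p0 H0).
  pose proof (dot_nonneg X p1 u H1 Hu); pose proof (dot_nonneg X p0 u H0 Hu).
  (* Expected weight 0 means [dot X p u = 0] or [mass X p' = 0]; either forces actual weight 0, as
     the tangent bounds require. *)
  assert (Hz : forall p', (forall x, 0 <= p' x) -> dot X p' u <= dot X p u ->
            dot X p u * mass X p' / mass X p = 0 -> dot X p' u = 0).
  { intros p' Hp' Hle Ez.
    assert (Ez' : dot X p u * mass X p' = 0).
    { replace (dot X p u * mass X p') with (dot X p u * mass X p' / mass X p * mass X p)
        by (field; lra). rewrite Ez; ring. }
    pose proof (dot_nonneg X p' u Hp' Hu).
    destruct (Rmult_integral _ _ Ez') as [Z|Z]; [lra|].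
    unfold dot; rewrite <- (sumL_0 X); apply sumL_ext; intros x Hx.
    rewrite (mass0_zero X p' x Hp') by (assumption || lra); ring. }
  assert (Hy : 0 <= y) by (apply Rle_mult_inv_pos; [apply Rmult_le_pos|]; lra).
  assert (Hy0 : 0 <= dot X p u * mass X p0 / mass X p)
    by (apply Rle_mult_inv_pos; [apply Rmult_le_pos|]; lra).
  assert (Hyy : y + dot X p u * mass X p0 / mass X p = dot X p u)
    by (unfold y; rewrite EM; field; rewrite <- EM; lra).
  pose proof (xlnx_ge (dot X p0 u) _ ltac:(lra) Hy0 (Hz p0 H0 ltac:(lra))) as K0.
  pose proof (xlnx_ge (dot X p1 u) _ ltac:(lra) Hy (Hz p1 H1 ltac:(lra))) as K1.
  pose proof (xlnx_ge_gap (dot X p1 u) _ l ltac:(lra) Hy Hl (Hz p1 H1 ltac:(lra))) as K1'.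
  pose proof (Rmult_le_pos (l ^ 2) y ltac:(nra) Hy).
  unfold Rmax; destruct (Rle_dec 0 (y - dot X p1 u)); lra.
Qed.

(** * Channels *)

(* A message of a communication channel: on input [(x, y)] it is sent with
   probability [ux x * vy y], and [lab] is the output it announces. *)
Record atom := Atom { lab : bool; ux : input -> R; vy : input -> R }.

Definition nonneg_atoms (ts : list atom) : Prop :=
  forall t, In t ts -> (forall x, 0 <= ux t x) /\ (forall y, 0 <= vy t y).

Definition is_channel (X Y : list input) (ts : list atom) : Prop :=
  forall x y, In x X -> In y Y -> sumL ts (fun t => ux t x * vy t y) = 1.

(* [mass X p * mass Y q] times the mutual information, in nats, between the
   inputs and the message when the inputs are drawn proportionally to [p x * q y]. *)
Definition info (X Y : list input) (p q : input -> R) (ts : list atom) : R :=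
  sumL ts (fun t => dot Y q (vy t) * ent X p (ux t) + dot X p (ux t) * ent Y q (vy t)).

Definition out_prob (ts : list atom) (z : bool) (x y : input) : R :=
  sumL ts (fun t => if Bool.eqb (lab t) z then ux t x * vy t y else 0).

(** Expectation under the unnormalised product law; without normalisation it is additive when [p] or
    [q] is split. *)
Definition esum (X Y : list input) (p q : input -> R) (F : input -> input -> R) : R :=
  sumL X (fun x => sumL Y (fun y => p x * q y * F x y)).

(** Exchanges the players, so that facts proved for questions to Alice transfer to Bob. *)
Definition swap_atom (t : atom) : atom := Atom (lab t) (vy t) (ux t).

Lemma esum_ext X Y p q F G :
  (forall x y, In x X -> In y Y -> F x y = G x y) -> esum X Y p q F = esum X Y p q G.
Proof.
  intros H; apply sumL_ext; intros x Hx; apply sumL_ext; intros y Hy; rewrite H; auto.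
Qed.

Lemma esum_le X Y p q F G :
  (forall x, 0 <= p x) -> (forall y, 0 <= q y) ->
  (forall x y, In x X -> In y Y -> F x y <= G x y) -> esum X Y p q F <= esum X Y p q G.
Proof.
  intros Hp Hq H; apply sumL_le; intros x Hx; apply sumL_le; intros y Hy.
  apply Rmult_le_compat_l; [apply Rmult_le_pos|]; auto.
Qed.

Lemma esum_plus X Y p q F G :
  esum X Y p q (fun x y => F x y + G x y) = esum X Y p q F + esum X Y p q G.
Proof.
  unfold esum; rewrite <- sumL_plus; apply sumL_ext; intros x _.
  rewrite <- sumL_plus; apply sumL_ext; intros; ring.
Qed.

Lemma esum_scal X Y p q c F :
  esum X Y p q (fun x y => c * F x y) = c * esum X Y p q F.
Proof.
  unfold esum; rewrite <- sumL_scal; apply sumL_ext; intros x _.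
  rewrite <- sumL_scal; apply sumL_ext; intros; ring.
Qed.

Lemma esum_const X Y p q c : esum X Y p q (fun _ _ => c) = c * (mass X p * mass Y q).
Proof.
  unfold esum, mass; rewrite <- sumL_prod, <- sumL_scal; apply sumL_ext; intros x _.
  rewrite <- sumL_scal; apply sumL_ext; intros; ring.
Qed.

Lemma esum_sumL {T} X Y p q (l : list T) (F : T -> input -> input -> R) :
  esum X Y p q (fun x y => sumL l (fun t => F t x y)) =
  sumL l (fun t => esum X Y p q (F t)).
Proof.
  unfold esum; symmetry; rewrite sumL_swap; apply sumL_ext; intros x _.
  rewrite sumL_swap; apply sumL_ext; intros y _; apply sumL_scal.
Qed.

Lemma esum_prod X Y p q (u v : input -> R) :
  esum X Y p q (fun x y => u x * v y) = dot X p u * dot Y q v.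
Proof.
  unfold dot; rewrite <- sumL_prod; apply sumL_ext; intros x _; apply sumL_ext; intros; ring.
Qed.

Lemma esum_plus_l X Y p1 p0 q F :
  esum X Y (fun x => p1 x + p0 x) q F = esum X Y p1 q F + esum X Y p0 q F.
Proof.
  unfold esum; rewrite <- sumL_plus; apply sumL_ext; intros x _.
  rewrite <- sumL_plus; apply sumL_ext; intros; ring.
Qed.

Lemma esum_plus_r X Y p q1 q0 F :
  esum X Y p (fun y => q1 y + q0 y) F = esum X Y p q1 F + esum X Y p q0 F.
Proof.
  unfold esum; rewrite <- sumL_plus; apply sumL_ext; intros x _.
  rewrite <- sumL_plus; apply sumL_ext; intros; ring.
Qed.

Lemma esum_out_prob X Y p q ts z (U V : input -> R) :
  esum X Y p q (fun x y => U x * V y * out_prob ts z x y) =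
  sumL ts (fun t => if Bool.eqb (lab t) z
                    then dot X p (fun x => U x * ux t x) * dot Y q (fun y => V y * vy t y)
                    else 0).
Proof.
  transitivity (sumL ts (fun t => esum X Y p q (fun x y =>
    if Bool.eqb (lab t) z then U x * V y * (ux t x * vy t y) else 0))).
  - rewrite <- esum_sumL; apply esum_ext; intros x y _ _.
    unfold out_prob; rewrite <- sumL_scal; apply sumL_ext; intros t _.
    destruct (Bool.eqb (lab t) z); ring.
  - apply sumL_ext; intros t _; destruct (Bool.eqb (lab t) z).
    + rewrite <- esum_prod; apply esum_ext; intros; ring.
    + rewrite esum_const; ring.
Qed.

Lemma dot_ext_u X (p u v : input -> R) :
  (forall x, In x X -> u x = v x) -> dot X p u = dot X p v.
Proof. intros H; apply sumL_ext; intros x Hx; rewrite H; auto. Qed.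

Lemma esum_out_prob_1 X Y p q ts z :
  esum X Y p q (out_prob ts z) =
  sumL ts (fun t => if Bool.eqb (lab t) z then dot X p (ux t) * dot Y q (vy t) else 0).
Proof.
  transitivity (esum X Y p q (fun x y => 1 * 1 * out_prob ts z x y)).
  - apply esum_ext; intros; ring.
  - rewrite (esum_out_prob X Y p q ts z (fun _ => 1) (fun _ => 1)).
    apply sumL_ext; intros t _.
    rewrite (dot_ext_u X p (fun x => 1 * ux t x) (ux t)) by (intros; ring).
    rewrite (dot_ext_u Y q (fun x => 1 * vy t x) (vy t)) by (intros; ring).
    reflexivity.
Qed.

Lemma out_prob_sum X Y ts x y :
  is_channel X Y ts -> In x X -> In y Y ->
  out_prob ts false x y + out_prob ts true x y = 1.
Proof.
  intros H Hx Hy; rewrite <- (H x y Hx Hy); unfold out_prob; rewrite <- sumL_plus.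
  apply sumL_ext; intros t _; destruct (lab t); cbn; ring.
Qed.

Lemma out_prob_nonneg ts z x y : nonneg_atoms ts -> 0 <= out_prob ts z x y.
Proof.
  intros H; apply sumL_nonneg; intros t Ht; destruct (H t Ht) as [Hu Hv].
  destruct (Bool.eqb (lab t) z); [apply Rmult_le_pos; auto|lra].
Qed.

Lemma channel_mass X Y p q ts :
  is_channel X Y ts ->
  sumL ts (fun t => dot X p (ux t) * dot Y q (vy t)) = mass X p * mass Y q.
Proof.
  intros H; transitivity (esum X Y p q (fun _ _ => 1)).
  - transitivity (sumL ts (fun t => esum X Y p q (fun x y => ux t x * vy t y))).
    + apply sumL_ext; intros; symmetry; apply esum_prod.
    + rewrite <- esum_sumL; apply esum_ext; auto.
  - rewrite esum_const; ring.
Qed.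

Lemma info_nonneg X Y p q ts :
  nonneg_atoms ts -> (forall x, 0 <= p x) -> (forall y, 0 <= q y) -> 0 <= info X Y p q ts.
Proof.
  intros H Hp Hq; apply sumL_nonneg; intros t Ht; destruct (H t Ht) as [Hu Hv].
  apply Rplus_le_le_0_compat; apply Rmult_le_pos;
    first [apply ent_nonneg; assumption | apply dot_nonneg; assumption].
Qed.

Lemma info_swap X Y p q ts : info Y X q p (map swap_atom ts) = info X Y p q ts.
Proof. unfold info; rewrite sumL_map; apply sumL_ext; intros t _; cbn; ring. Qed.

Lemma nonneg_atoms_swap ts : nonneg_atoms ts -> nonneg_atoms (map swap_atom ts).
Proof.
  intros H t Ht; apply in_map_iff in Ht; destruct Ht as [s [<- Hs]].
  destruct (H s Hs); cbn; auto.
Qed.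

Lemma is_channel_swap X Y ts : is_channel X Y ts -> is_channel Y X (map swap_atom ts).
Proof.
  intros H y x Hy Hx; rewrite sumL_map, <- (H x y Hx Hy).
  apply sumL_ext; intros; cbn; ring.
Qed.

Lemma dot_le X (p u v : input -> R) :
  (forall x, 0 <= p x) -> (forall x, In x X -> u x <= v x) -> dot X p u <= dot X p v.
Proof. intros Hp H; apply sumL_le; intros x Hx; apply Rmult_le_compat_l; auto. Qed.

(** The cap is [L] times the mean of [u]; dividing by it turns the truncated weight into a fuzzy set
    with values in [0, 1]. *)
Definition trunc (X : list input) (p : input -> R) (L : R) (u : input -> R) (x : input) : R :=
  Rmin (u x) (L * dot X p u / mass X p).

Lemma trunc_bounds X p L u x :
  (forall x, 0 <= p x) -> (forall x, 0 <= u x) -> 0 < mass X p -> 0 < L ->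
  0 <= trunc X p L u x <= u x.
Proof.
  intros Hp Hu HP HL; pose proof (dot_nonneg X p u Hp Hu); split.
  - apply Rmin_glb; [apply Hu|]; apply Rle_mult_inv_pos; [nra|lra].
  - apply Rmin_l.
Qed.

(* Averaging over the messages announcing [true]: the truncation costs at most
   [info / (ln L - 1)], and the right-hand side of the last hypothesis is [M] times
   the variance of [out_prob ts false]. *)
Lemma exists_depleting_atom X Y p q ts (s L : R) :
  nonneg_atoms ts -> is_channel X Y ts ->
  (forall x, 0 <= p x) -> (forall y, 0 <= q y) -> 0 < mass X p -> 0 < mass Y q ->
  0 < L -> 1 < ln L ->
  let M := mass X p * mass Y q in
  info X Y p q ts <= (ln L - 1) * s * M ->
  s * M < esum X Y p q (out_prob ts false) * esum X Y p q (out_prob ts true) / M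
          - esum X Y p q (fun x y => out_prob ts false x y * out_prob ts true x y) ->
  exists t, In t ts /\
    let U := trunc X p L (ux t) in let V := trunc Y q L (vy t) in
    s * (dot X p (ux t) * dot Y q (vy t)) <
    dot X p U * dot Y q V * esum X Y p q (out_prob ts false) / M
    - esum X Y p q (fun x y => U x * V y * out_prob ts false x y).
Proof.
  intros Hts Hch Hp Hq HP HQ HL0 HL M Hinfo HD.
  set (N0 := esum X Y p q (out_prob ts false)) in *.
  set (N1 := esum X Y p q (out_prob ts true)) in *.
  set (G := esum X Y p q (fun x y => out_prob ts false x y * out_prob ts true x y)) in *.
  assert (HM : 0 < M) by (apply Rmult_lt_0_compat; assumption).
  assert (HN : N0 + N1 = M).
  { unfold N0, N1; rewrite <- esum_plus.
    rewrite (esum_ext _ _ _ _ _ (fun _ _ => 1))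
      by (intros; eapply out_prob_sum; eauto).
    rewrite esum_const; unfold M; ring. }
  assert (HN0 : 0 <= N0).
  { unfold N0; rewrite <- (Rmult_0_l (mass X p * mass Y q)), <- esum_const.
    apply esum_le; auto; intros; apply out_prob_nonneg; auto. }
  set (tu t := trunc X p L (ux t)). set (tv t := trunc Y q L (vy t)).
  set (sel (t : atom) (r : R) := if Bool.eqb (lab t) true then r else 0).
  (* Truncating the two factors one after the other costs a message at most its summand of [info],
     divided by [ln L - 1]. *)
  assert (H1 : N1 - s * M <= sumL ts (fun t => sel t (dot X p (tu t) * dot Y q (tv t)))).
  { assert (HT : sumL ts (fun t => sel t (dot X p (ux t) * dot Y q (vy t)) -
                     sel t (dot X p (tu t) * dot Y q (tv t))) <= s * M).
    { apply Rle_trans with (info X Y p q ts * / (ln L - 1)).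
      - unfold info; rewrite <- sumL_scalr; apply sumL_le; intros t Ht.
        destruct (Hts t Ht) as [Hu Hv].
        pose proof (ent_truncation X p (ux t) L Hp Hu HP HL0 HL) as TU.
        pose proof (ent_truncation Y q (vy t) L Hq Hv HQ HL0 HL) as TV.
        change (fun x => Rmin (ux t x) (L * dot X p (ux t) / mass X p)) with (tu t) in TU.
        change (fun x => Rmin (vy t x) (L * dot Y q (vy t) / mass Y q)) with (tv t) in TV.
        assert (Bu : forall x, 0 <= tu t x <= ux t x)
          by (intros; apply trunc_bounds; assumption).
        assert (Bv : forall x, 0 <= tv t x <= vy t x)
          by (intros; apply trunc_bounds; assumption).
        assert (Au : dot X p (tu t) <= dot X p (ux t))
          by (apply dot_le; [assumption|intros; apply Bu]).
        assert (Av : dot Y q (tv t) <= dot Y q (vy t))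
          by (apply dot_le; [assumption|intros; apply Bv]).
        pose proof (dot_nonneg X p (ux t) Hp Hu); pose proof (dot_nonneg Y q (vy t) Hq Hv).
        pose proof (dot_nonneg X p (tu t) Hp (fun x => proj1 (Bu x))).
        pose proof (ent_nonneg X p (ux t) Hp Hu); pose proof (ent_nonneg Y q (vy t) Hq Hv).
        assert (0 < / (ln L - 1)) by (apply Rinv_0_lt_compat; lra).
        unfold Rdiv in TU, TV; unfold sel.
        assert (0 <= ent X p (ux t) * / (ln L - 1)) by (apply Rmult_le_pos; lra).
        assert (0 <= ent Y q (vy t) * / (ln L - 1)) by (apply Rmult_le_pos; lra).
        destruct (Bool.eqb (lab t) true); nra.
      - apply Rmult_le_reg_r with (ln L - 1); [lra|].
        rewrite Rmult_assoc, Rinv_l by lra; lra. }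
    rewrite sumL_minus in HT; unfold sel at 1 in HT.
    rewrite <- esum_out_prob_1 in HT; fold N1 in HT; lra. }
  (* Removing the truncation only increases the left side, and the untruncated sum over the messages
     announcing [true] is exactly [G]. *)
  assert (H2 : sumL ts (fun t => sel t (esum X Y p q (fun x y =>
                 tu t x * tv t y * out_prob ts false x y))) <= G).
  { apply Rle_trans with (sumL ts (fun t => esum X Y p q (fun x y =>
      sel t (ux t x * vy t y) * out_prob ts false x y))).
    - apply sumL_le; intros t Ht; destruct (Hts t Ht) as [Hu Hv]; unfold sel.
      destruct (Bool.eqb (lab t) true).
      + apply esum_le; auto; intros x y _ _.
        apply Rmult_le_compat_r; [apply out_prob_nonneg; assumption|].
        apply Rmult_le_compat; apply trunc_bounds; assumption.
      + right; rewrite (esum_ext _ _ _ _ _ (fun _ _ => 0)) by (intros; ring).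
        rewrite esum_const; ring.
    - right; rewrite <- esum_sumL; apply esum_ext; intros x y _ _.
      unfold sel; rewrite sumL_scalr; unfold out_prob; ring. }
  assert (H3 : sumL ts (fun t => sel t (dot X p (ux t) * dot Y q (vy t))) = N1)
    by (symmetry; apply esum_out_prob_1).
  (* The losses [s * N0] from truncation and [s * N1] from the demanded surplus add up to [s * M],
     which the variance exceeds; so some summand is positive. *)
  destruct (sumL_pos_exists ts (fun t =>
    sel t (dot X p (tu t) * dot Y q (tv t)) * (N0 / M)
    - sel t (esum X Y p q (fun x y => tu t x * tv t y * out_prob ts false x y))
    - s * sel t (dot X p (ux t) * dot Y q (vy t)))) as [t [Ht Hpos]].
  - rewrite !sumL_minus, sumL_scalr, sumL_scal, H3.
    assert (0 <= N0 / M) by (apply Rle_mult_inv_pos; lra).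
    assert ((N1 - s * M) * (N0 / M) <=
       sumL ts (fun t => sel t (dot X p (tu t) * dot Y q (tv t))) * (N0 / M))
      by (apply Rmult_le_compat_r; assumption).
    replace ((N1 - s * M) * (N0 / M)) with (N0 * N1 / M - s * N0) in H0 by (field; lra).
    nra.
  - exists t; split; [exact Ht|]; fold (tu t) (tv t); cbn zeta.
    unfold sel in Hpos; destruct (Bool.eqb (lab t) true); [|lra].
    unfold Rdiv in *; lra.
Qed.

(** * Questions that lower the information *)

(* By how much the messages announcing [false] lose weight when the law [p] of
   the first input is reweighted by [U]. *)
Definition depletion (X Y : list input) (p q U : input -> R) (ts : list atom) : R :=
  sumL ts (fun t => if Bool.eqb (lab t) false then
    dot Y q (vy t) * Rmax 0 (dot X p (ux t) * dot X p U / mass X p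
                             - dot X p (fun x => U x * ux t x)) else 0).

(** For each message announcing [false], the deficit of a product is at most the deficits of its
    factors: [yA * yB - I * J <= Rmax 0 (yA - I) * yB + Rmax 0 (yB - J) * yA]. One of the two
    resulting sums carries half of [D]. *)
Lemma depleted_side X Y p q ts (s : R) (U V : input -> R) :
  nonneg_atoms ts ->
  (forall x, 0 <= p x) -> (forall y, 0 <= q y) -> 0 < mass X p -> 0 < mass Y q ->
  (forall x, 0 <= U x) -> (forall y, 0 <= V y) ->
  let D := dot X p U * dot Y q V * esum X Y p q (out_prob ts false)
             / (mass X p * mass Y q)
           - esum X Y p q (fun x y => U x * V y * out_prob ts false x y) in
  s < D ->
  s / 2 < depletion X Y p q U ts * (dot Y q V / mass Y q) \/
  s / 2 < depletion Y X q p V (map swap_atom ts) * (dot X p U / mass X p).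
Proof.
  intros Hts Hp Hq HP HQ HU HV D HD.
  assert (Hle : D <= depletion X Y p q U ts * (dot Y q V / mass Y q)
                   + depletion Y X q p V (map swap_atom ts) * (dot X p U / mass X p)).
  { unfold D, depletion, Rdiv at 1.
    set (k := / (mass X p * mass Y q)).
    rewrite esum_out_prob, esum_out_prob_1, sumL_map, <- !sumL_scalr.
    rewrite <- sumL_scal, <- sumL_scalr, <- sumL_minus, <- sumL_plus.
    apply sumL_le; intros t Ht; destruct (Hts t Ht) as [Hu Hv].
    cbn [lab ux vy swap_atom].
    destruct (Bool.eqb (lab t) false); [|lra].
    pose proof (dot_nonneg X p (ux t) Hp Hu) as Ha.
    pose proof (dot_nonneg Y q (vy t) Hq Hv) as Hb.
    pose proof (dot_nonneg X p U Hp HU) as HA.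
    pose proof (dot_nonneg Y q V Hq HV) as HB.
    pose proof (dot_nonneg X p _ Hp (fun x => Rmult_le_pos _ _ (HU x) (Hu x))) as HI.
    pose proof (dot_nonneg Y q _ Hq (fun x => Rmult_le_pos _ _ (HV x) (Hv x))) as HJ.
    cbv beta in HI, HJ.
    set (I := dot X p (fun x => U x * ux t x)) in *.
    set (J := dot Y q (fun x => V x * vy t x)) in *.
    set (A := dot X p U) in *. set (B := dot Y q V) in *.
    set (a := dot X p (ux t)) in *. set (b := dot Y q (vy t)) in *.
    set (P := mass X p) in *. set (Q := mass Y q) in *.
    assert (0 <= a * A / P) by (apply Rle_mult_inv_pos; [apply Rmult_le_pos|]; lra).
    assert (0 <= b * B / Q) by (apply Rle_mult_inv_pos; [apply Rmult_le_pos|]; lra).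
    replace (A * B * (a * b) * k) with (a * A / P * (b * B / Q)) by (unfold k; field; lra).
    replace (b * Rmax 0 (a * A / P - I) * (B / Q)) with
      (Rmax 0 (a * A / P - I) * (b * B / Q)) by (field; lra).
    replace (a * Rmax 0 (b * B / Q - J) * (A / P)) with
      (Rmax 0 (b * B / Q - J) * (a * A / P)) by (field; lra).
    set (yA := a * A / P) in *. set (yB := b * B / Q) in *.
    clearbody yA yB I J; unfold Rmax.
    destruct (Rle_dec 0 (yA - I)) as [h1|h1], (Rle_dec 0 (yB - J)) as [h2|h2].
    - pose proof (Rmult_le_pos _ _ h1 h2); lra.
    - pose proof (Rmult_le_pos I (J - yB) HI ltac:(lra)); lra.
    - pose proof (Rmult_le_pos J (I - yA) HJ ltac:(lra)); lra.
    - pose proof (Rmult_le_compat yA I yB J ltac:(lra) ltac:(lra) ltac:(lra) ltac:(lra)); lra. }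
  destruct (Rlt_le_dec (s / 2) (depletion X Y p q U ts * (dot Y q V / mass Y q)));
    [left; assumption|right; lra].
Qed.

(** The requirements on a fuzzy question [w]: the answer [true] is not too rare, and the information
    falls in proportion to its mass. *)
Definition info_drop (X Y : list input) (p q : input -> R) (ts : list atom)
  (s L : R) (w : input -> R) : Prop :=
  (forall x, 0 <= w x <= 1) /\
  s / 2 / L * mass X p <= dot X p w /\
  info X Y (fun x => p x * w x) q ts + info X Y (fun x => p x * (1 - w x)) q ts
    + s ^ 2 / 16 * (dot X p w * mass Y q) <= info X Y p q ts.

(** A deficit never exceeds the expected weight, and the expected weights sum to the right side. A
    large depletion therefore forces [dot X p U] to be large. *)
Lemma depletion_le X Y p q U ts :
  nonneg_atoms ts -> is_channel X Y ts ->
  (forall x, 0 <= p x) -> (forall y, 0 <= q y) -> 0 < mass X p ->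
  (forall x, 0 <= U x) ->
  depletion X Y p q U ts <= dot X p U * mass Y q.
Proof.
  intros Hts Hch Hp Hq HP HU.
  apply Rle_trans with
    (sumL ts (fun t => dot X p (ux t) * dot Y q (vy t)) * (dot X p U / mass X p)).
  - rewrite <- sumL_scalr; apply sumL_le; intros t Ht; destruct (Hts t Ht) as [Hu Hv].
    pose proof (dot_nonneg X p (ux t) Hp Hu) as Ha.
    pose proof (dot_nonneg Y q (vy t) Hq Hv) as Hb.
    pose proof (dot_nonneg X p U Hp HU) as HA.
    pose proof (dot_nonneg X p _ Hp (fun x => Rmult_le_pos _ _ (HU x) (Hu x))) as HI.
    cbv beta in HI.
    assert (0 <= dot X p (ux t) * dot X p U / mass X p)
      by (apply Rle_mult_inv_pos; [apply Rmult_le_pos|]; lra).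
    replace (dot X p (ux t) * dot Y q (vy t) * (dot X p U / mass X p)) with
      (dot Y q (vy t) * (dot X p (ux t) * dot X p U / mass X p)) by (field; lra).
    destruct (Bool.eqb (lab t) false).
    + apply Rmult_le_compat_l; [assumption|]; apply Rmax_lub; lra.
    + apply Rmult_le_pos; assumption.
  - rewrite (channel_mass X Y p q ts Hch); right; field; lra.
Qed.

(** Apply [ent_split] to Alice's factor of each message, weighted by Bob's; the entropies of Bob's
    factors contribute additively. The gaps of the messages announcing [false] sum to the depletion,
    while the quadratic losses sum to the mass of the answer [true]. *)
Lemma info_drop_of_depletion X Y p q ts (s L a tau : R) (U : input -> R) :
  nonneg_atoms ts -> is_channel X Y ts ->
  (forall x, 0 <= p x) -> (forall y, 0 <= q y) -> 0 < mass X p -> 0 < mass Y q ->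
  0 < s -> 0 < L -> tau = L * a / mass X p ->
  (forall x, 0 <= U x <= tau) -> dot X p U <= a ->
  s / 2 * (a * mass Y q) < depletion X Y p q U ts ->
  info_drop X Y p q ts s L (fun x => U x / tau).
Proof.
  intros Hts Hch Hp Hq HP HQ Hs HL Htau HU HA HD.
  assert (HU0 : forall x, 0 <= U x) by (intros; apply HU).
  pose proof (dot_nonneg X p U Hp HU0) as HA0.
  pose proof (depletion_le X Y p q U ts Hts Hch Hp Hq HP HU0) as HDle.
  assert (HAa : s / 2 * a < dot X p U).
  { apply Rmult_lt_reg_r with (mass Y q); [assumption|lra]. }
  assert (Ha : 0 < a) by nra.
  assert (Ht : 0 < tau) by (subst; apply Rdiv_lt_0_compat; nra).
  set (w x := U x / tau).
  assert (Hw : forall x, 0 <= w x <= 1).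
  { intros x; split; [apply Rle_mult_inv_pos; auto|].
    apply Rmult_le_reg_r with tau; [assumption|].
    unfold w, Rdiv; rewrite Rmult_assoc, Rinv_l by lra; destruct (HU x); lra. }
  assert (Ew : dot X p w = dot X p U / tau).
  { unfold w, Rdiv, dot; rewrite <- sumL_scalr; apply sumL_ext; intros; ring. }
  split; [exact Hw|split].
  { rewrite Ew, Htau.
    replace (s / 2 / L * mass X p) with (s / 2 * a / (L * a / mass X p)) by (field; lra).
    apply Rmult_le_compat_r; [|lra].
    left; apply Rinv_0_lt_compat; rewrite <- Htau; exact Ht. }
  set (p1 x := p x * w x). set (p0 x := p x * (1 - w x)).
  assert (H1 : forall x, 0 <= p1 x)
    by (intros x; apply Rmult_le_pos; [apply Hp|apply Hw]).
  assert (H0 : forall x, 0 <= p0 x)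
    by (intros x; apply Rmult_le_pos; [apply Hp|destruct (Hw x); lra]).
  assert (E : forall x, p x = p1 x + p0 x) by (intros; unfold p1, p0; ring).
  assert (EP1 : mass X p1 = dot X p w) by reflexivity.
  (* This value maximises [l * (s / 2) - l ^ 2]; the maximum is [s ^ 2 / 16]. *)
  set (l := s / 4).
  set (y t := dot X p (ux t) * mass X p1 / mass X p).
  assert (Hsum : info X Y p1 q ts + info X Y p0 q ts +
    sumL ts (fun t => l * (if Bool.eqb (lab t) false then
        dot Y q (vy t) * Rmax 0 (y t - dot X p1 (ux t)) else 0)
      - l ^ 2 * (dot Y q (vy t) * y t)) <= info X Y p q ts).
  { unfold info; rewrite <- !sumL_plus; apply sumL_le; intros t Htt.
    destruct (Hts t Htt) as [Hu Hv].
    assert (ED : dot X p (ux t) = dot X p1 (ux t) + dot X p0 (ux t)).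
    { rewrite <- dot_plus_l; apply sumL_ext; intros; rewrite E; reflexivity. }
    assert (Hy : 0 <= y t).
    { apply Rle_mult_inv_pos; [apply Rmult_le_pos|lra];
        [apply dot_nonneg|apply mass_nonneg]; assumption. }
    pose proof (dot_nonneg Y q (vy t) Hq Hv) as Hb.
    pose proof (ent_split X p p1 p0 (ux t) l E H1 H0 Hu HP ltac:(unfold l; lra)) as S1.
    (* The messages announcing [true] use parameter 0, that is, only that splitting does not raise
       the entropy. *)
    pose proof (ent_split X p p1 p0 (ux t) 0 E H1 H0 Hu HP ltac:(lra)) as S0.
    fold (y t) in S1, S0; cbv zeta in S1, S0.
    assert (0 <= l ^ 2 * y t) by (apply Rmult_le_pos; [apply pow2_ge_0|lra]).
    set (rm := Rmax 0 (y t - dot X p1 (ux t))) in *.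
    rewrite ED.
    destruct (Bool.eqb (lab t) false).
    - apply (Rmult_le_compat_l _ _ _ Hb) in S1; lra.
    - assert (S2 : ent X p1 (ux t) + ent X p0 (ux t) - l ^ 2 * y t <= ent X p (ux t)) by lra.
      apply (Rmult_le_compat_l _ _ _ Hb) in S2; lra. }
  rewrite sumL_minus, !sumL_scal in Hsum.
  assert (Edep : sumL ts (fun t => if Bool.eqb (lab t) false then
        dot Y q (vy t) * Rmax 0 (y t - dot X p1 (ux t)) else 0)
      = depletion X Y p q U ts / tau).
  { unfold depletion, Rdiv at 1; rewrite <- sumL_scalr; apply sumL_ext; intros t _.
    destruct (Bool.eqb (lab t) false); [|ring].
    rewrite Rmult_assoc; f_equal.
    rewrite (Rmult_comm _ (/ tau)), <- RmaxRmult
      by (left; apply Rinv_0_lt_compat; assumption).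
    f_equal; [ring|].
    unfold y; rewrite EP1, Ew.
    replace (dot X p1 (ux t)) with (/ tau * dot X p (fun x => U x * ux t x)).
    - field; lra.
    - unfold dot, p1, w; rewrite <- sumL_scal; apply sumL_ext; intros; field; lra. }
  assert (Ey : sumL ts (fun t => dot Y q (vy t) * y t) = dot X p w * mass Y q).
  { transitivity (sumL ts (fun t => dot X p (ux t) * dot Y q (vy t)) * (mass X p1 / mass X p)).
    - rewrite <- sumL_scalr; apply sumL_ext; intros; unfold y; field; lra.
    - rewrite (channel_mass X Y p q ts Hch), EP1; field; lra. }
  rewrite Edep, Ey in Hsum.
  assert (HD' : s / 2 * (dot X p w * mass Y q) <= depletion X Y p q U ts / tau).
  { rewrite Ew; apply Rmult_le_reg_r with tau; [assumption|].
    replace (s / 2 * (dot X p U / tau * mass Y q) * tau) with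
      (s / 2 * (dot X p U * mass Y q)) by (field; lra).
    replace (depletion X Y p q U ts / tau * tau) with (depletion X Y p q U ts)
      by (field; lra).
    apply Rle_trans with (s / 2 * (a * mass Y q)); [|lra].
    apply Rmult_le_compat_l; [lra|]; apply Rmult_le_compat_r; lra. }
  apply (Rmult_le_compat_l l) in HD'; [|unfold l; lra].
  unfold l in *; lra.
Qed.

(** Take the message of [exists_depleting_atom] and question the side that [depleted_side] selects.
    The other side's truncated weight is at most its full weight, which then cancels. *)
Lemma exists_info_drop X Y p q ts (s L : R) :
  nonneg_atoms ts -> is_channel X Y ts ->
  (forall x, 0 <= p x) -> (forall y, 0 <= q y) -> 0 < mass X p -> 0 < mass Y q ->
  0 < s -> 0 < L -> 1 < ln L ->
  let M := mass X p * mass Y q in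
  info X Y p q ts <= (ln L - 1) * s * M ->
  s * M < esum X Y p q (out_prob ts false) * esum X Y p q (out_prob ts true) / M
          - esum X Y p q (fun x y => out_prob ts false x y * out_prob ts true x y) ->
  (exists w, info_drop X Y p q ts s L w) \/
  (exists w, info_drop Y X q p (map swap_atom ts) s L w).
Proof.
  intros Hts Hch Hp Hq HP HQ Hs HL0 HL M Hinfo HD.
  destruct (exists_depleting_atom X Y p q ts s L Hts Hch Hp Hq HP HQ HL0 HL Hinfo HD)
    as [t [Ht Hlt]].
  destruct (Hts t Ht) as [Hu Hv]; cbv zeta in Hlt.
  pose proof (fun x => trunc_bounds X p L (ux t) x Hp Hu HP HL0) as BU.
  pose proof (fun x => trunc_bounds Y q L (vy t) x Hq Hv HQ HL0) as BV.
  pose proof (dot_nonneg X p (ux t) Hp Hu) as Ha.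
  pose proof (dot_nonneg Y q (vy t) Hq Hv) as Hb.
  assert (HA : dot X p (trunc X p L (ux t)) <= dot X p (ux t))
    by (apply dot_le; [assumption|intros; apply BU]).
  assert (HB : dot Y q (trunc Y q L (vy t)) <= dot Y q (vy t))
    by (apply dot_le; [assumption|intros; apply BV]).
  assert (HU : forall x, 0 <= trunc X p L (ux t) x <= L * dot X p (ux t) / mass X p)
    by (intros x; split; [apply BU|apply Rmin_r]).
  assert (HV : forall x, 0 <= trunc Y q L (vy t) x <= L * dot Y q (vy t) / mass Y q)
    by (intros x; split; [apply BV|apply Rmin_r]).
  destruct (depleted_side X Y p q ts _ (trunc X p L (ux t)) (trunc Y q L (vy t))
    Hts Hp Hq HP HQ (fun x => proj1 (BU x)) (fun x => proj1 (BV x)) Hlt) as [C|C].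
  - left; exists (fun x => trunc X p L (ux t) x / (L * dot X p (ux t) / mass X p)).
    apply info_drop_of_depletion with (a := dot X p (ux t)); auto.
    set (d := depletion _ _ _ _ _ _) in *.
    assert (Hd : 0 <= d).
    { apply sumL_nonneg; intros r Hr; destruct (Hts r Hr) as [_ Hrv].
      destruct (Bool.eqb (lab r) false); [|lra].
      apply Rmult_le_pos; [apply dot_nonneg; assumption|apply Rmax_l]. }
    set (a := dot X p (ux t)) in *. set (b := dot Y q (vy t)) in *.
    set (Q := mass Y q) in *. set (B := dot Y q (trunc Y q L (vy t))) in *.
    assert (C' : s * (a * b) / 2 * Q < d * B).
    { apply Rmult_lt_reg_r with (/ Q); [apply Rinv_0_lt_compat; assumption|].
      replace (s * (a * b) / 2 * Q * / Q) with (s * (a * b) / 2) by (field; lra).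
      unfold Rdiv in C; lra. }
    assert (d * B <= d * b) by (apply Rmult_le_compat_l; assumption).
    destruct (Req_dec b 0) as [E|E]; [rewrite E in *; lra|].
    apply Rmult_lt_reg_r with b; lra.
  - right; exists (fun x => trunc Y q L (vy t) x / (L * dot Y q (vy t) / mass Y q)).
    apply info_drop_of_depletion with (a := dot Y q (vy t));
      auto using nonneg_atoms_swap, is_channel_swap.
    set (d := depletion _ _ _ _ _ _) in *.
    assert (Hd : 0 <= d).
    { apply sumL_nonneg; intros r Hr.
      destruct (nonneg_atoms_swap ts Hts r Hr) as [_ Hrv].
      destruct (Bool.eqb (lab r) false); [|lra].
      apply Rmult_le_pos; [apply dot_nonneg; assumption|apply Rmax_l]. }
    set (a := dot X p (ux t)) in *. set (b := dot Y q (vy t)) in *.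
    set (P := mass X p) in *. set (A := dot X p (trunc X p L (ux t))) in *.
    assert (C' : s * (a * b) / 2 * P < d * A).
    { apply Rmult_lt_reg_r with (/ P); [apply Rinv_0_lt_compat; assumption|].
      replace (s * (a * b) / 2 * P * / P) with (s * (a * b) / 2) by (field; lra).
      unfold Rdiv in C; lra. }
    assert (d * A <= d * a) by (apply Rmult_le_compat_l; assumption).
    destruct (Req_dec a 0) as [E|E]; [rewrite E in *; lra|].
    apply Rmult_lt_reg_r with a; lra.
Qed.

(** * Protocol trees *)

(** [T] is the fuel for questions along a path and [r] that for answers [true]; once either is used
    up only a leaf may follow. *)
Fixpoint narrow (t : dtree) (r T : nat) : Prop :=
  match t with
  | DLeaf _ => True
  | DA _ t0 t1 | DB _ t0 t1 =>
      match r, T with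
      | S r', S T' => narrow t0 r T' /\ narrow t1 r' T'
      | _, _ => False
      end
  end.

(* A chain of questions, to Alice if the flag is set and to Bob otherwise, each
   with the tree to be followed as soon as its answer is [true]. *)
Definition chain := list (bool * (input -> bool) * dtree).

Definition ask (q : bool * (input -> bool) * dtree) (x y : input) : bool :=
  let '(s, g, _) := q in if s then g x else g y.

Fixpoint chain_eval (L : chain) (e : dtree) (x y : input) : bool :=
  match L with
  | [] => deval e x y
  | q :: L' => if ask q x y then deval (snd q) x y else chain_eval L' e x y
  end.

Lemma chain_eval_app L1 L2 e x y :
  chain_eval (L1 ++ L2) e x y =
  if existsb (fun q => ask q x y) L1 then chain_eval L1 e x y else chain_eval L2 e x y.
Proof.
  induction L1 as [|q L1 IH]; [reflexivity|].
  cbn; destruct (ask q x y); [reflexivity|exact IH].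
Qed.

(** Alice can compute this bit alone; with [hitB] it tells in two bits whether a chain contains an
    answer [true]. *)
Definition hitA (L : chain) (x : input) : bool :=
  existsb (fun q => fst (fst q) && snd (fst q) x) L.

Definition hitB (L : chain) (y : input) : bool :=
  existsb (fun q => negb (fst (fst q)) && snd (fst q) y) L.

Lemma hit_ask L x y : existsb (fun q => ask q x y) L = hitA L x || hitB L y.
Proof.
  induction L as [|[[s g] t] L IH]; [reflexivity|]; cbn; rewrite IH.
  fold (hitA L x) (hitB L y); unfold hitA, hitB.
  destruct s; cbn; [destruct (g x)|destruct (g y)]; cbn; try reflexivity;
    rewrite ?orb_true_r; reflexivity.
Qed.

(* Binary search for the first question answered by [true]. *)
Lemma chain_search (m : nat) : forall (L : chain) (e : dtree) (c : nat),
  (length L <= 2 ^ m)%nat -> (dcost e <= c)%nat ->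
  (forall q, In q L -> (dcost (snd q) <= c)%nat) ->
  exists t, (dcost t <= 2 * m + 1 + c)%nat /\ forall x y, deval t x y = chain_eval L e x y.
Proof.
  induction m as [|m IH]; intros L e c HL He Hc.
  - destruct L as [|[[s g] t1] [|q' L]]; cbn in HL; [| |lia].
    + exists e; split; [lia|reflexivity].
    + specialize (Hc _ (or_introl eq_refl)); cbn in Hc.
      exists (if s then DA g e t1 else DB g e t1).
      split; [destruct s; cbn; lia|intros x y; destruct s; reflexivity].
  - rewrite <- (firstn_skipn (2 ^ m) L) in Hc |- *.
    pose proof (length_firstn (2 ^ m) L) as l1; pose proof (length_skipn (2 ^ m) L) as l2.
    cbn in HL; set (L1 := firstn _ L) in *; set (L2 := skipn _ L) in *.
    destruct (IH L1 e c) as [t1 [C1 E1]]; [lia|lia|intros; apply Hc, in_or_app; auto|].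
    destruct (IH L2 e c) as [t2 [C2 E2]]; [lia|lia|intros; apply Hc, in_or_app; auto|].
    (* At most two bits decide in which half the first answer [true] lies; the extra 1 in the cost
       is the single question left at the end. *)
    exists (DA (hitA L1) (DB (hitB L1) t2 t1) t1); split; [cbn [dcost]; lia|intros x y].
    rewrite chain_eval_app, hit_ask; cbn.
    destruct (hitA L1 x), (hitB L1 y); cbn; auto.
Qed.

(** The path of answers [false] from the root is a chain of at most [T] questions. An answer [true]
    leads into a subtree with one unit of [r] less, so there are at most [r] binary searches. *)
Lemma narrow_compress (m r : nat) : forall (T : nat) (t : dtree),
  (T <= 2 ^ m)%nat -> narrow t r T ->
  exists t', (dcost t' <= r * (2 * m + 1))%nat /\ forall x y, deval t' x y = deval t x y.
Proof.
  induction r as [|r IH]; intros T t HT Ht.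
  - exists t; split; [|reflexivity]; destruct t; cbn in Ht; [cbn; lia|easy|easy].
  - assert (HL : exists L z, (length L <= T)%nat /\
      (forall q, In q L -> (dcost (snd q) <= r * (2 * m + 1))%nat) /\
      forall x y, chain_eval L (DLeaf z) x y = deval t x y).
    { revert T HT Ht; induction t as [z|g t0 IH0 t1 _|g t0 IH0 t1 _]; intros T HT Ht.
      - exists [], z; cbn; split; [lia|split; [easy|reflexivity]].
      - destruct T as [|T]; [destruct Ht|]; destruct Ht as [N0 N1].
        destruct (IH0 T ltac:(lia) N0) as [L [z [HL [HC HE]]]].
        destruct (IH T t1 ltac:(lia) N1) as [t' [C' E']].
        exists ((true, g, t') :: L), z; split; [cbn; lia|split].
        + intros q [<-|Hq]; [exact C'|auto].
        + intros x y; cbn; rewrite HE, E'; reflexivity.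
      - destruct T as [|T]; [destruct Ht|]; destruct Ht as [N0 N1].
        destruct (IH0 T ltac:(lia) N0) as [L [z [HL [HC HE]]]].
        destruct (IH T t1 ltac:(lia) N1) as [t' [C' E']].
        exists ((false, g, t') :: L), z; split; [cbn; lia|split].
        + intros q [<-|Hq]; [exact C'|auto].
        + intros x y; cbn; rewrite HE, E'; reflexivity. }
    destruct HL as [L [z [HL [HC HE]]]].
    destruct (chain_search m L (DLeaf z) _ ltac:(lia) (Nat.le_0_l _) HC) as [t' [C' E']].
    exists t'; split; [lia|intros; rewrite E'; apply HE].
Qed.

(** * Rounding fuzzy questions, and the error at a leaf *)

Definition perr (X Y : list input) (p q : input -> R) (f : input -> input -> bool)
  (t : dtree) : R :=
  esum X Y p q (fun x y => bool_err (deval t x y) (f x y)).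

Definition channel_err (X Y : list input) (p q : input -> R)
  (f : input -> input -> bool) (ts : list atom) : R :=
  esum X Y p q (fun x y => out_prob ts (negb (f x y)) x y).

Lemma bool_err_bounds a b : 0 <= bool_err a b <= 1.
Proof. unfold bool_err; destruct (Bool.eqb a b); lra. Qed.

Lemma perr_le_mass X Y p q f t :
  (forall x, 0 <= p x) -> (forall y, 0 <= q y) ->
  perr X Y p q f t <= mass X p * mass Y q.
Proof.
  intros Hp Hq; rewrite <- (Rmult_1_l (_ * _)), <- esum_const.
  apply esum_le; auto; intros; apply bool_err_bounds.
Qed.

(* A fuzzy split of the law can be replaced by a deterministic question: each
   [x] is sent to the branch in which it errs less. *)
Lemma split_rounding_A X Y p p1 p0 q f t1 t0 :
  (forall x, p x = p1 x + p0 x) -> (forall x, 0 <= p1 x) -> (forall x, 0 <= p0 x) ->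
  exists g, perr X Y p q f (DA g t0 t1) <= perr X Y p1 q f t1 + perr X Y p0 q f t0.
Proof.
  intros E H1 H0.
  set (e t x := sumL Y (fun y => q y * bool_err (deval t x y) (f x y))).
  assert (Ee : forall p t, perr X Y p q f t = sumL X (fun x => p x * e t x)).
  { intros p' t; unfold perr, esum, e; apply sumL_ext; intros x _.
    rewrite <- sumL_scal; apply sumL_ext; intros; ring. }
  exists (fun x => if Rlt_dec (e t1 x) (e t0 x) then true else false).
  rewrite !Ee, <- sumL_plus; apply sumL_le; intros x _.
  rewrite E; unfold e at 1; cbn [deval].
  pose proof (H1 x); pose proof (H0 x).
  destruct (Rlt_dec (e t1 x) (e t0 x)) as [h|h].
  - fold (e t1 x); nra.
  - fold (e t0 x); nra.
Qed.

Lemma split_rounding_B X Y p q q1 q0 f t1 t0 :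
  (forall y, q y = q1 y + q0 y) -> (forall y, 0 <= q1 y) -> (forall y, 0 <= q0 y) ->
  exists g, perr X Y p q f (DB g t0 t1) <= perr X Y p q1 f t1 + perr X Y p q0 f t0.
Proof.
  intros E H1 H0.
  set (e t y := sumL X (fun x => p x * bool_err (deval t x y) (f x y))).
  assert (Ee : forall q t, perr X Y p q f t = sumL Y (fun y => q y * e t y)).
  { intros q' t; unfold perr, esum, e; rewrite sumL_swap; apply sumL_ext; intros y _.
    rewrite <- sumL_scal; apply sumL_ext; intros; ring. }
  exists (fun y => if Rlt_dec (e t1 y) (e t0 y) then true else false).
  rewrite !Ee, <- sumL_plus; apply sumL_le; intros y _.
  rewrite E; unfold e at 1; cbn [deval].
  pose proof (H1 y); pose proof (H0 y).
  destruct (Rlt_dec (e t1 y) (e t0 y)) as [h|h].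
  - fold (e t1 y); nra.
  - fold (e t0 y); nra.
Qed.

(** [W] stands for the probability that the channel announces the majority output on an input where
    that output is wrong, and [o] for the mean of that probability: either [W] is large or it lies
    far below the mean. *)
Lemma one_le_quadratic (W o : R) : 0 <= W -> / 2 <= o -> 1 <= 3 * W + 8 * (W - o) ^ 2.
Proof.
  intros HW Ho; destruct (Rle_lt_dec (1 / 2) W) as [h|h].
  { pose proof (pow2_ge_0 (W - o)); lra. }
  assert ((1 / 2 - W) ^ 2 <= (W - o) ^ 2) by nra.
  (* 5/16 is the vertex of [3 * W + 8 * (1 / 2 - W) ^ 2], whose minimum 39/32 exceeds 1. *)
  pose proof (pow2_ge_0 (W - 5 / 16)); nra.
Qed.

(* The difference in the hypothesis is [M] times the variance of [out_prob ts false]. *)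
Lemma leaf_error X Y p q f ts (s : R) :
  nonneg_atoms ts -> is_channel X Y ts ->
  (forall x, 0 <= p x) -> (forall y, 0 <= q y) ->
  let M := mass X p * mass Y q in
  0 < M ->
  esum X Y p q (out_prob ts false) * esum X Y p q (out_prob ts true) / M
    - esum X Y p q (fun x y => out_prob ts false x y * out_prob ts true x y) <= s * M ->
  exists z, perr X Y p q f (DLeaf z) <= 3 * channel_err X Y p q f ts + 8 * s * M.
Proof.
  intros Hts Hch Hp Hq M HM HD.
  set (N0 := esum X Y p q (out_prob ts false)) in *.
  set (N1 := esum X Y p q (out_prob ts true)) in *.
  set (G := esum X Y p q (fun x y => out_prob ts false x y * out_prob ts true x y)) in *.
  assert (HN : N0 + N1 = M).
  { unfold N0, N1; rewrite <- esum_plus.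
    rewrite (esum_ext _ _ _ _ _ (fun _ _ => 1))
      by (intros; eapply out_prob_sum; eauto).
    rewrite esum_const; unfold M; ring. }
  set (o := N0 / M).
  (* The two output probabilities sum to 1, so their product is [W - W ^ 2] for [W] the first of
     them. *)
  assert (Evar : esum X Y p q (fun x y => (out_prob ts false x y - o) ^ 2) = N0 * N1 / M - G).
  { rewrite (esum_ext _ _ _ _ _ (fun x y =>
      (-1) * (out_prob ts false x y * out_prob ts true x y) +
      ((1 - 2 * o) * out_prob ts false x y + o ^ 2))).
    - rewrite !esum_plus, !esum_scal, esum_const.
      fold G N0 M; replace N1 with (M - N0) by lra; unfold o; field; lra.
    - intros x y Hx Hy; pose proof (out_prob_sum X Y ts x y Hch Hx Hy) as E.
      replace (out_prob ts true x y) with (1 - out_prob ts false x y) by lra; ring. }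
  assert (Hfin : forall z, (forall x y, In x X -> In y Y ->
      bool_err z (f x y) <= 3 * out_prob ts (negb (f x y)) x y
                            + 8 * (out_prob ts false x y - o) ^ 2) ->
      perr X Y p q f (DLeaf z) <= 3 * channel_err X Y p q f ts + 8 * s * M).
  { intros z Hz; apply Rle_trans with (3 * channel_err X Y p q f ts + 8 * (N0 * N1 / M - G)).
    - rewrite <- Evar; unfold channel_err; rewrite <- !esum_scal, <- esum_plus.
      apply esum_le; auto.
    - lra. }
  destruct (Rle_lt_dec (/ 2) o) as [Ho|Ho]; [exists false|exists true];
    apply Hfin; intros x y Hx Hy; unfold bool_err;
    pose proof (out_prob_sum X Y ts x y Hch Hx Hy) as E;
    pose proof (out_prob_nonneg ts false x y Hts) as W0;
    pose proof (out_prob_nonneg ts true x y Hts) as W1;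
    pose proof (pow2_ge_0 (out_prob ts false x y - o));
    destruct (f x y); cbn [negb Bool.eqb]; try lra.
  - apply one_le_quadratic; assumption.
  - pose proof (one_le_quadratic (out_prob ts true x y) (1 - o) W1 ltac:(lra)) as K.
    replace ((out_prob ts true x y - (1 - o)) ^ 2) with
      ((out_prob ts false x y - o) ^ 2) in K; [exact K|].
    replace (out_prob ts true x y) with (1 - out_prob ts false x y) by lra; ring.
Qed.

(* [i2] and [i3] are the charges, per unit of mass, for a question answered by
   [true] and for any question; the budget [1 - r * i2] or [1 - T * i3] is
   exhausted when the fuel [r] or [T] is. *)
Lemma exists_narrow_protocol X Y f ts (s L gam i2 i3 : R) :
  nonneg_atoms ts -> is_channel X Y ts ->
  0 < s -> 0 < L -> 1 < ln L -> 0 <= i2 -> 0 <= i3 ->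
  1 <= gam * ((ln L - 1) * s) -> i2 + i3 / (s / 2 / L) <= gam * (s ^ 2 / 16) ->
  forall (T r : nat) (p q : input -> R),
  (forall x, 0 <= p x) -> (forall y, 0 <= q y) -> INR r * i2 <= 1 -> INR T * i3 <= 1 ->
  exists t, narrow t r T /\
    perr X Y p q f t <= 3 * channel_err X Y p q f ts + gam * info X Y p q ts
      + (mass X p * mass Y q) * (8 * s + (1 - INR r * i2) + (1 - INR T * i3)).
Proof.
  intros Hts Hch Hs HL0 HL Hi2 Hi3 Hg1 Hg2.
  assert (Hg : 0 < gam).
  { destruct (Rlt_le_dec 0 gam); [assumption|].
    assert (0 < (ln L - 1) * s) by (apply Rmult_lt_0_compat; lra); nra. }
  assert (Hal : 0 < s / 2 / L) by (apply Rdiv_lt_0_compat; lra).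
  assert (Hi : 0 <= i3 / (s / 2 / L)) by (apply Rle_mult_inv_pos; lra).
  induction T as [|T IH]; intros r p q Hp Hq Hr HT;
    pose proof (mass_nonneg X p Hp) as HP; pose proof (mass_nonneg Y q Hq) as HQ;
    pose proof (info_nonneg X Y p q ts Hts Hp Hq) as Hinf;
    pose proof (Rmult_le_pos _ _ HP HQ) as HM;
    pose proof (Rmult_le_pos gam _ ltac:(lra) Hinf) as Hgi;
    assert (Hce : 0 <= channel_err X Y p q f ts)
      by (rewrite <- (Rmult_0_l (mass X p * mass Y q)), <- esum_const;
          apply esum_le; auto; intros; apply out_prob_nonneg; assumption).
  (* Exhausted fuel leaves a charge of 1 per unit of mass, which covers the trivial error bound;
     likewise for [r = 0] below. *)
  { exists (DLeaf true); split; [exact I|].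
    pose proof (perr_le_mass X Y p q f (DLeaf true) Hp Hq); cbn [INR]; nra. }
  destruct r as [|r].
  { exists (DLeaf true); split; [exact I|].
    pose proof (perr_le_mass X Y p q f (DLeaf true) Hp Hq); cbn [INR] in *; nra. }
  set (M := mass X p * mass Y q) in *.
  assert (HMb : 0 <= M * ((1 - INR (S r) * i2) + (1 - INR (S T) * i3)))
    by (apply Rmult_le_pos; lra).
  destruct (Rlt_le_dec 0 M) as [HM0|HM0]; cycle 1.
  { exists (DLeaf true); split; [exact I|].
    pose proof (perr_le_mass X Y p q f (DLeaf true) Hp Hq); fold M in H; nra. }
  assert (HP0 : 0 < mass X p) by (unfold M in HM0; nra).
  assert (HQ0 : 0 < mass Y q) by (unfold M in HM0; nra).
  (* If the information is too large for the truncation, [gam * info] alone covers the whole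
     mass. *)
  destruct (Rle_lt_dec (info X Y p q ts) ((ln L - 1) * s * M)) as [HI|HI]; cycle 1.
  { exists (DLeaf true); split; [exact I|].
    pose proof (perr_le_mass X Y p q f (DLeaf true) Hp Hq); fold M in H.
    assert (M <= gam * info X Y p q ts).
    { apply Rle_trans with (gam * ((ln L - 1) * s * M)).
      - replace (gam * ((ln L - 1) * s * M)) with (gam * ((ln L - 1) * s) * M) by ring.
        rewrite <- (Rmult_1_l M) at 1; apply Rmult_le_compat_r; assumption.
      - apply Rmult_le_compat_l; lra. }
    nra. }
  (* With small variance a leaf suffices; otherwise some question lowers the information. *)
  destruct (Rlt_le_dec (s * M)
    (esum X Y p q (out_prob ts false) * esum X Y p q (out_prob ts true) / M
     - esum X Y p q (fun x y => out_prob ts false x y * out_prob ts true x y)))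
    as [HD|HD]; cycle 1.
  { destruct (leaf_error X Y p q f ts s Hts Hch Hp Hq HM0 HD) as [z Hz]; fold M in Hz.
    exists (DLeaf z); split; [exact I|]; nra. }
  rewrite S_INR in Hr, HT; rewrite !S_INR.
  destruct (exists_info_drop X Y p q ts s L Hts Hch Hp Hq HP0 HQ0 Hs HL0 HL HI HD)
    as [[w [Hw [Hlow Hdrop]]]|[w [Hw [Hlow Hdrop]]]].
  - set (p1 x := p x * w x) in *. set (p0 x := p x * (1 - w x)) in *.
    assert (H1 : forall x, 0 <= p1 x)
      by (intros x; apply Rmult_le_pos; [apply Hp|apply Hw]).
    assert (H0 : forall x, 0 <= p0 x)
      by (intros x; apply Rmult_le_pos; [apply Hp|destruct (Hw x); lra]).
    assert (E : forall x, p x = p1 x + p0 x) by (intros; unfold p1, p0; ring).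
    destruct (IH r p1 q H1 Hq ltac:(lra) ltac:(lra)) as [t1 [N1 B1]].
    destruct (IH (S r) p0 q H0 Hq ltac:(rewrite S_INR; lra) ltac:(lra)) as [t0 [N0 B0]].
    rewrite S_INR in B0.
    destruct (split_rounding_A X Y p p1 p0 q f t1 t0 E H1 H0) as [g Bg].
    exists (DA g t0 t1); split; [split; assumption|].
    assert (EC : channel_err X Y p q f ts = channel_err X Y p1 q f ts + channel_err X Y p0 q f ts).
    { unfold channel_err; rewrite <- esum_plus_l; apply sumL_ext; intros x _.
      apply sumL_ext; intros; rewrite E; reflexivity. }
    assert (EM : mass X p = mass X p1 + mass X p0).
    { unfold mass; rewrite <- sumL_plus; apply sumL_ext; intros; apply E. }
    change (dot X p w) with (mass X p1) in *.
    (* The answer [true] uses a unit of [r], and both answers use one of [T]. As [p1] has at least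
       the fraction [s / 2 / L] of the mass, both charges are proportional to its mass and are paid
       for by the drop of information. *)
    assert (Hcharge : mass X p1 * mass Y q * i2 + M * i3
      <= gam * (s ^ 2 / 16 * (mass X p1 * mass Y q))).
    { apply Rle_trans with ((i2 + i3 / (s / 2 / L)) * (mass X p1 * mass Y q)).
      - assert (M * i3 <= i3 / (s / 2 / L) * (mass X p1 * mass Y q)); [|lra].
        apply Rle_trans with (i3 / (s / 2 / L) * (s / 2 / L * mass X p * mass Y q)).
        + right; unfold M; field; lra.
        + apply Rmult_le_compat_l; [assumption|].
          apply Rmult_le_compat_r; assumption.
      - rewrite <- (Rmult_assoc gam); apply Rmult_le_compat_r; [|assumption].
        apply Rmult_le_pos; [apply mass_nonneg|]; assumption. }
    apply (Rmult_le_compat_l gam) in Hdrop; [|lra].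
    unfold M in *; rewrite EC; rewrite EM in *; lra.
  - set (q1 x := q x * w x) in *. set (q0 x := q x * (1 - w x)) in *.
    rewrite !info_swap in Hdrop.
    assert (H1 : forall x, 0 <= q1 x)
      by (intros x; apply Rmult_le_pos; [apply Hq|apply Hw]).
    assert (H0 : forall x, 0 <= q0 x)
      by (intros x; apply Rmult_le_pos; [apply Hq|destruct (Hw x); lra]).
    assert (E : forall x, q x = q1 x + q0 x) by (intros; unfold q1, q0; ring).
    destruct (IH r p q1 Hp H1 ltac:(lra) ltac:(lra)) as [t1 [N1 B1]].
    destruct (IH (S r) p q0 Hp H0 ltac:(rewrite S_INR; lra) ltac:(lra)) as [t0 [N0 B0]].
    rewrite S_INR in B0.
    destruct (split_rounding_B X Y p q q1 q0 f t1 t0 E H1 H0) as [g Bg].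
    exists (DB g t0 t1); split; [split; assumption|].
    assert (EC : channel_err X Y p q f ts = channel_err X Y p q1 f ts + channel_err X Y p q0 f ts).
    { unfold channel_err; rewrite <- esum_plus_r; apply sumL_ext; intros x _.
      apply sumL_ext; intros; rewrite E; reflexivity. }
    assert (EM : mass Y q = mass Y q1 + mass Y q0).
    { unfold mass; rewrite <- sumL_plus; apply sumL_ext; intros; apply E. }
    change (dot Y q w) with (mass Y q1) in *.
    assert (Hcharge : mass X p * mass Y q1 * i2 + M * i3
      <= gam * (s ^ 2 / 16 * (mass Y q1 * mass X p))).
    { apply Rle_trans with ((i2 + i3 / (s / 2 / L)) * (mass X p * mass Y q1)).
      - assert (M * i3 <= i3 / (s / 2 / L) * (mass X p * mass Y q1)); [|lra].
        apply Rle_trans with (i3 / (s / 2 / L) * (mass X p * (s / 2 / L * mass Y q))).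
        + right; unfold M; field; lra.
        + apply Rmult_le_compat_l; [assumption|].
          apply Rmult_le_compat_l; assumption.
      - rewrite <- (Rmult_assoc gam), (Rmult_comm (mass Y q1)); apply Rmult_le_compat_r;
          [|assumption].
        apply Rmult_le_pos; [|apply mass_nonneg]; assumption. }
    apply (Rmult_le_compat_l gam) in Hdrop; [|lra].
    unfold M in *; rewrite EC; rewrite EM in *; lra.
Qed.

(** * Choice of the parameters *)

Lemma exists_nat_ceil (x : R) : 0 <= x -> exists n, x <= INR n <= x + 1.
Proof.
  intros Hx; exists (Z.to_nat (up x)); destruct (archimed x) as [h1 h2].
  assert (0 <= up x)%Z by (apply le_IZR; lra).
  rewrite INR_IZR_INZ, Z2Nat.id by assumption; lra.
Qed.

Lemma pow2_exp (m : nat) : 2 ^ m = exp (INR m * ln 2).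
Proof. rewrite <- (Rpower_pow m 2) by lra; reflexivity. Qed.

Lemma exp_le_compat (x y : R) : x <= y -> exp x <= exp y.
Proof. intros [H| ->]; [left; apply exp_increasing; exact H|apply Rle_refl]. Qed.

Lemma CC_le_mono n mu eps f b b' : b <= b' -> CC_le n mu eps f b -> CC_le n mu eps f b'.
Proof. intros H [t [He Hc]]; exists t; split; [exact He|lra]. Qed.

(** Both the number [r] of answers [true] and the length [m] of a binary search are linear in
    [K + 1], so [narrow_compress] gives a quadratic cost. *)
Lemma CC_le_of_channel : exists C0 : R, 0 < C0 /\
  forall n f muX muY ts K,
  is_dist1 n muX -> is_dist1 n muY ->
  nonneg_atoms ts -> is_channel (bits n) (bits n) ts ->
  channel_err (bits n) (bits n) muX muY f ts <= 1 / 8 ->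
  0 <= K -> info (bits n) (bits n) muX muY ts <= K ->
  CC_le n (fun x y => muX x * muY y) (49 / 100) f (C0 * (K + 1) ^ 2).
Proof.
  (* The least integer with [2 / A <= 3 / 40 * ((1 / 200) ^ 2 / 16)], the inequality by which the
     information drop pays for both charges. *)
  set (A := 17066667).
  exists ((A + 1) * 33000); split; [unfold A; lra|].
  intros n f muX muY ts K [HX SX] [HY SY] Hts Hch Herr HK0 HK.
  set (k := K + 1). assert (Hk : 1 <= k) by (unfold k; lra).
  set (L := exp (1 + 8000 * k)).
  assert (HlnL : ln L = 1 + 8000 * k) by apply ln_exp.
  assert (HL : 0 < L) by apply exp_pos.
  destruct (exists_nat_ceil (A * k)) as [r [Hr1 Hr2]]; [unfold A; lra|].
  destruct (exists_nat_ceil (2 * (34 + 8001 * k))) as [m [Hm1 Hm2]]; [lra|].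
  (* [m] is twice the exponent [33 + k + (1 + 8000 * k)], rounded up, because [ln 2] is only bounded
     below by 1/2. *)
  assert (HT : 400 * A * k * L <= 2 ^ m).
  { pose proof ln_lt_2 as l2; pose proof (ln_le_sub_1 2 ltac:(lra)) as l2'.
    assert (E1 : 400 * A <= exp 33).
    { apply Rle_trans with (2 ^ 33); [unfold A; lra|].
      rewrite pow2_exp; apply exp_le_compat; cbn [INR]; lra. }
    assert (E2 : k <= exp k).
    { assert (1 + k < exp k) by (apply exp_ineq1; lra); lra. }
    apply Rle_trans with (exp 33 * exp k * L).
    - apply Rmult_le_compat_r; [lra|]; apply Rmult_le_compat; unfold A in *; lra.
    - unfold L; rewrite <- !exp_plus, pow2_exp; apply exp_le_compat.
      apply Rle_trans with (INR m * / 2); [lra|].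
      apply Rmult_le_compat_l; [apply pos_INR|lra]. }
  assert (Hr0 : 0 < INR r) by (unfold A in *; lra).
  assert (HT0 : 0 < 2 ^ m) by (apply pow_lt; lra).
  assert (Hi2 : 0 < / INR r) by (apply Rinv_0_lt_compat; assumption).
  assert (Hi3 : 0 < / 2 ^ m) by (apply Rinv_0_lt_compat; assumption).
  assert (HINR : INR (2 ^ m) = 2 ^ m) by (rewrite pow_INR; reflexivity).
  assert (HAk : 0 < A * k) by (unfold A; lra).
  (* The charges vanish at the root since [r] and [T] are the inverses of [i2] and [i3]. What
     remains is 3/8 from the channel, 3/40 from the information and 8/200 from the variance, exactly
     49/100. *)
  destruct (exists_narrow_protocol (bits n) (bits n) f ts (1 / 200) L (3 / (40 * k))
    (/ INR r) (/ 2 ^ m) Hts Hch) with (T := (2 ^ m)%nat) (r := r) (p := muX) (q := muY)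
    as [t [Nt Et]]; try lra; try assumption.
  - rewrite HlnL.
    replace (3 / (40 * k) * ((1 + 8000 * k - 1) * (1 / 200))) with 3 by (field; lra); lra.
  - (* each of the two summands is at most [1 / (A * k)] *)
    apply Rle_trans with (2 / (A * k)).
    + assert (/ INR r <= / (A * k)) by (apply Rinv_le_contravar; assumption).
      assert (/ 2 ^ m / (1 / 200 / 2 / L) <= / (A * k)).
      { replace (/ 2 ^ m / (1 / 200 / 2 / L)) with (400 * L * / 2 ^ m) by (field; lra).
        apply Rle_trans with (400 * L * / (400 * A * k * L)).
        - apply Rmult_le_compat_l; [lra|]; apply Rinv_le_contravar; [|assumption].
          unfold A; apply Rmult_lt_0_compat; lra.
        - right; unfold A; field; lra. }
      unfold Rdiv in *; lra.
    + unfold A; apply Rmult_le_reg_r with k; [lra|].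
      replace (2 / (17066667 * k) * k) with (2 / 17066667) by (field; lra).
      replace (3 / (40 * k) * ((1 / 200) ^ 2 / 16) * k) with (3 / 40 * ((1 / 200) ^ 2 / 16))
        by (field; lra).
      lra.
  - rewrite Rinv_r by lra; lra.
  - rewrite HINR, Rinv_r by lra; lra.
  - destruct (narrow_compress m r (2 ^ m) t (Nat.le_refl _) Nt) as [t' [Ct' Et']].
    exists t'; split.
    + change (perr (bits n) (bits n) muX muY f t' <= 49 / 100).
      replace (perr (bits n) (bits n) muX muY f t') with (perr (bits n) (bits n) muX muY f t)
        by (apply esum_ext; intros; rewrite Et'; reflexivity).
      assert (EX : mass (bits n : list input) muX = 1) by exact SX.
      assert (EY : mass (bits n : list input) muY = 1) by exact SY.
      rewrite EX, EY, HINR, !Rinv_r in Et by lra.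
      assert (3 / (40 * k) * info (bits n) (bits n) muX muY ts <= 3 / 40).
      { apply Rle_trans with (3 / (40 * k) * k).
        - apply Rmult_le_compat_l; [|unfold k; lra].
          apply Rle_mult_inv_pos; lra.
        - right; field; lra. }
      lra.
    + apply Rle_trans with (INR r * (2 * INR m + 1)).
      * apply le_INR in Ct'; rewrite mult_INR, plus_INR, mult_INR in Ct'.
        cbn [INR] in Ct'; lra.
      * apply Rle_trans with (((A + 1) * k) * (33000 * k)).
        { apply Rmult_le_compat; lra. }
        right; fold k; ring.
Qed.

(** * The partition bound *)

Definition ind (c : R) (A : list input) (x : input) : R := if memb x A then c else 0.

(** On an input, a pair of output and rectangle containing that input is sent with its weight in the
    linear program; the weight is put on Alice's factor. *)
Definition rect_channel (n : nat) (w : bool -> rect -> R) : list atom :=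
  flat_map (fun z => map (fun Rc => Atom z (ind (w z Rc) (fst Rc)) (ind 1 (snd Rc))) (rects n))
    [false; true].

Lemma ind_nonneg c A x : 0 <= c -> 0 <= ind c A x.
Proof. intros H; unfold ind; destruct (memb x A); lra. Qed.

Lemma ind_scal c A x : ind c A x = c * ind 1 A x.
Proof. unfold ind; destruct (memb x A); ring. Qed.

Lemma dot_ind X p c A : dot X p (ind c A) = c * dot X p (ind 1 A).
Proof.
  unfold dot; rewrite <- sumL_scal; apply sumL_ext; intros x _; rewrite ind_scal; ring.
Qed.

(** Conditioning on a set of probability [a] has relative entropy [- ln a]; the scale [c] cancels
    inside the logarithm. *)
Lemma ent_ind X (p : input -> R) c A :
  (forall x, 0 <= p x) -> mass X p = 1 -> 0 <= c ->
  ent X p (ind c A) = - (c * (dot X p (ind 1 A) * ln (dot X p (ind 1 A)))).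
Proof.
  intros Hp HP Hc; set (a := dot X p (ind 1 A)).
  unfold ent; rewrite HP, dot_ind; fold a.
  transitivity (sumL X (fun x => p x * ind 1 A x * - (c * ln a))).
  - apply sumL_ext; intros x Hx.
    destruct (Req_dec (p x * ind 1 A x * c) 0) as [E|E].
    + rewrite ind_scal; transitivity (p x * ind 1 A x * c *
        ln (c * ind 1 A x * 1 / (c * a))); [ring|].
      rewrite E; transitivity (- (p x * ind 1 A x * c) * ln a); [rewrite E|]; ring.
    + pose proof (dot_ge_term X p (ind 1 A) x Hp (fun y => ind_nonneg 1 A y Rle_0_1) Hx) as Ha.
      fold a in Ha; pose proof (Hp x).
      revert E Ha; unfold ind; destruct (memb x A); intros E Ha; [|exfalso; apply E; ring].
      assert (c <> 0) by (intros ->; apply E; ring).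
      assert (p x <> 0) by (intros Z; apply E; rewrite Z; ring).
      assert (0 < a) by lra.
      replace (c * 1 / (c * a)) with (/ a) by (field; lra).
      rewrite ln_Rinv by assumption; ring.
  - rewrite sumL_scalr; fold (dot X p (ind 1 A)); fold a; ring.
Qed.

(* Weighted form of the concavity of the logarithm. *)
Lemma rect_info_le (w a b c : R) :
  0 <= w -> 0 <= a -> 0 <= b -> 0 < c ->
  b * - (w * (a * ln a)) + w * a * - (1 * (b * ln b)) <= w * (a * b) * ln c + w * / c - w * (a * b).
Proof.
  intros Hw Ha Hb Hc; pose proof (Rinv_0_lt_compat c Hc).
  destruct (Req_dec a 0) as [->|Na]; [nra|].
  destruct (Req_dec b 0) as [->|Nb]; [nra|].
  assert (Hm : 0 < a * b) by (apply Rmult_lt_0_compat; lra).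
  pose proof (ln_le_sub_1 (/ (a * b * c)) ltac:(apply Rinv_0_lt_compat; nra)) as L.
  rewrite ln_Rinv, !ln_mult in L by nra.
  apply (Rmult_le_compat_l (w * (a * b))) in L; [|nra].
  replace (w * (a * b) * (/ (a * b * c) - 1)) with (w * / c - w * (a * b)) in L by (field; lra).
  lra.
Qed.

Lemma rect_channel_nonneg n w :
  (forall z Rc, 0 <= w z Rc) -> nonneg_atoms (rect_channel n w).
Proof.
  intros Hw t Ht; apply in_flat_map in Ht; destruct Ht as [z [_ Ht]].
  apply in_map_iff in Ht; destruct Ht as [Rc [<- _]]; cbn.
  split; intros; apply ind_nonneg; [apply Hw|lra].
Qed.

Lemma rect_channel_out_prob n w z x y :
  out_prob (rect_channel n w) z x y =
  sumL (rects n) (fun Rc => if in_rect x y Rc then w z Rc else 0).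
Proof.
  unfold out_prob, rect_channel; rewrite sumL_flat_map.
  assert (E : forall z', sumL (map (fun Rc => Atom z' (ind (w z' Rc) (fst Rc))
        (ind 1 (snd Rc))) (rects n))
      (fun t => if Bool.eqb (lab t) z then ux t x * vy t y else 0) =
    if Bool.eqb z' z then sumL (rects n) (fun Rc => if in_rect x y Rc then w z' Rc else 0)
    else 0).
  { intros z'; rewrite sumL_map; cbn [lab ux vy]; rewrite sumL_if.
    destruct (Bool.eqb z' z); [|reflexivity].
    apply sumL_ext; intros Rc _; unfold ind, in_rect.
    destruct (memb x (fst Rc)), (memb y (snd Rc)); cbn; ring. }
  rewrite !sumL_cons, !E; destruct z; cbn; ring.
Qed.

Lemma rect_channel_is_channel n f w :
  prt_feasible n (1 / 8) f w -> is_channel (bits n) (bits n) (rect_channel n w).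
Proof.
  intros [_ H] x y Hx Hy; destruct (H x y Hx Hy) as [_ <-].
  transitivity (out_prob (rect_channel n w) false x y + out_prob (rect_channel n w) true x y).
  - unfold out_prob; rewrite <- sumL_plus; apply sumL_ext; intros t _.
    destruct (lab t); cbn; ring.
  - rewrite !rect_channel_out_prob, <- sumL_plus; apply sumL_ext; intros Rc _.
    destruct (in_rect x y Rc); [|ring]. cbn; ring.
Qed.

Lemma rect_channel_err n f w muX muY :
  is_dist1 n muX -> is_dist1 n muY -> prt_feasible n (1 / 8) f w ->
  channel_err (bits n) (bits n) muX muY f (rect_channel n w) <= 1 / 8.
Proof.
  intros [HX SX] [HY SY] Hf.
  apply Rle_trans with (esum (bits n) (bits n) muX muY (fun _ _ => 1 / 8)).
  - apply esum_le; auto; intros x y Hx Hy.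
    pose proof (out_prob_sum _ _ _ x y (rect_channel_is_channel n f w Hf) Hx Hy) as E.
    destruct Hf as [_ Hf]; destruct (Hf x y Hx Hy) as [H _].
    rewrite <- rect_channel_out_prob in H.
    destruct (f x y); cbn [negb]; lra.
  - rewrite esum_const.
    assert (EX : mass (bits n : list input) muX = 1) by exact SX.
    assert (EY : mass (bits n : list input) muY = 1) by exact SY.
    rewrite EX, EY; lra.
Qed.

(** A rectangle of product measure [a * b] contributes [- w * a * b * ln (a * b)]. In the sum of the
    bounds [rect_info_le] the linear terms cancel, as the [w] sum to [c] and the [w * a * b] to
    1. *)
Lemma rect_channel_info n f w muX muY :
  is_dist1 n muX -> is_dist1 n muY -> prt_feasible n (1 / 8) f w ->
  0 < prt_obj n w ->
  info (bits n) (bits n) muX muY (rect_channel n w) <= ln (prt_obj n w).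
Proof.
  intros [HX SX] [HY SY] Hf Hc; set (c := prt_obj n w) in *.
  pose proof (channel_mass (bits n) (bits n) muX muY _ (rect_channel_is_channel n f w Hf)) as Hm.
  destruct Hf as [Hw _].
  assert (EX : mass (bits n : list input) muX = 1) by exact SX.
  assert (EY : mass (bits n : list input) muY = 1) by exact SY.
  rewrite EX, EY in Hm.
  unfold rect_channel in *; unfold info; rewrite sumL_flat_map in *.
  set (a (Rc : rect) := dot (bits n : list input) muX (ind 1 (fst Rc))).
  set (b (Rc : rect) := dot (bits n : list input) muY (ind 1 (snd Rc))).
  assert (Hm' : sumL [false; true] (fun z =>
      sumL (rects n) (fun Rc => w z Rc * (a Rc * b Rc))) = 1).
  { rewrite <- (Rmult_1_l 1), <- Hm; apply sumL_ext; intros z _; rewrite sumL_map.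
    apply sumL_ext; intros Rc _; cbn [ux vy].
    rewrite (dot_ind (bits n) muX); unfold a, b; ring. }
  apply Rle_trans with (sumL [false; true] (fun z => sumL (rects n) (fun Rc =>
    w z Rc * (a Rc * b Rc) * ln c + w z Rc * / c - w z Rc * (a Rc * b Rc)))).
  - apply sumL_le; intros z _; rewrite sumL_map; apply sumL_le; intros Rc _; cbn [ux vy].
    rewrite !ent_ind, (dot_ind _ _ (w z Rc)) by first [assumption | apply Hw | lra].
    apply rect_info_le; try assumption; [apply Hw| |];
      apply dot_nonneg; try assumption; intros; apply ind_nonneg; lra.
  - right; transitivity (sumL [false; true] (fun z =>
        sumL (rects n) (fun Rc => w z Rc * (a Rc * b Rc)) * (ln c - 1)
        + sumL (rects n) (w z) * / c)).
    + apply sumL_ext; intros z _; rewrite sumL_minus, sumL_plus, !sumL_scalr; ring.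
    + rewrite sumL_plus, !sumL_scalr, Hm'.
      replace (sumL [false; true] (fun z => sumL (rects n) (w z))) with c
        by reflexivity.
      field; lra.
Qed.

Lemma bits_nonempty n : exists x, In x (bits n).
Proof.
  induction n as [|n [x Hx]]; [exists []; left; reflexivity|].
  exists (false :: x); cbn; apply in_or_app; left; apply in_map; exact Hx.
Qed.

(** The weights of the rectangles through a single point already sum to 1. *)
Lemma prt_obj_ge_1 n f w : prt_feasible n (1 / 8) f w -> 1 <= prt_obj n w.
Proof.
  intros [Hw H]; destruct (bits_nonempty n) as [x Hx].
  destruct (H x x Hx Hx) as [_ <-]; unfold prt_obj; rewrite sumL_swap.
  apply sumL_le; intros Rc _; destruct (in_rect x x Rc); [apply Rle_refl|].
  apply sumL_nonneg; intros; apply Hw.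
Qed.

(** * Information complexity *)

(** Alice's coins along the path; with [bob_prob] this is the product form that makes a transcript a
    message of a channel. *)
Fixpoint alice_prob (t : ptree) (x : input) (path : list bool) : R :=
  match t, path with
  | PLeaf _, [] => 1
  | PA p t0 _, false :: rest => (1 - p x) * alice_prob t0 x rest
  | PA p _ t1, true :: rest => p x * alice_prob t1 x rest
  | PB _ t0 _, false :: rest => alice_prob t0 x rest
  | PB _ _ t1, true :: rest => alice_prob t1 x rest
  | _, _ => 0
  end.

Fixpoint bob_prob (t : ptree) (y : input) (path : list bool) : R :=
  match t, path with
  | PLeaf _, [] => 1
  | PA _ t0 _, false :: rest => bob_prob t0 y rest
  | PA _ _ t1, true :: rest => bob_prob t1 y rest
  | PB q t0 _, false :: rest => (1 - q y) * bob_prob t0 y rest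
  | PB q _ t1, true :: rest => q y * bob_prob t1 y rest
  | _, _ => 0
  end.

Lemma tprob_factor t x y : forall path,
  tprob t x y path = alice_prob t x path * bob_prob t y path.
Proof.
  induction t as [z|p t0 IH0 t1 IH1|q t0 IH0 t1 IH1]; intros [|[] rest]; cbn;
    rewrite ?IH0, ?IH1; ring.
Qed.

Lemma ptree_prob_nonneg t : valid_ptree t -> forall u path,
  0 <= alice_prob t u path /\ 0 <= bob_prob t u path.
Proof.
  induction t as [z|p t0 IH0 t1 IH1|q t0 IH0 t1 IH1]; intros V u [|[] rest]; cbn;
    try lra; destruct V as [V [V0 V1]]; specialize (V u);
    destruct (IH0 V0 u rest), (IH1 V1 u rest); split; try assumption;
    apply Rmult_le_pos; lra.
Qed.

Lemma sumL_leaves_PA p t0 t1 x y (h : bool -> R) :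
  sumL (leaves (PA p t0 t1)) (fun pz => tprob (PA p t0 t1) x y (fst pz) * h (snd pz)) =
  (1 - p x) * sumL (leaves t0) (fun pz => tprob t0 x y (fst pz) * h (snd pz)) +
  p x * sumL (leaves t1) (fun pz => tprob t1 x y (fst pz) * h (snd pz)).
Proof.
  cbn [leaves]; rewrite sumL_app, !sumL_map, <- !sumL_scal.
  f_equal; apply sumL_ext; intros; cbn; ring.
Qed.

Lemma sumL_leaves_PB q t0 t1 x y (h : bool -> R) :
  sumL (leaves (PB q t0 t1)) (fun pz => tprob (PB q t0 t1) x y (fst pz) * h (snd pz)) =
  (1 - q y) * sumL (leaves t0) (fun pz => tprob t0 x y (fst pz) * h (snd pz)) +
  q y * sumL (leaves t1) (fun pz => tprob t1 x y (fst pz) * h (snd pz)).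
Proof.
  cbn [leaves]; rewrite sumL_app, !sumL_map, <- !sumL_scal.
  f_equal; apply sumL_ext; intros; cbn; ring.
Qed.

Lemma tprob_sum t x y : sumL (leaves t) (fun pz => tprob t x y (fst pz)) = 1.
Proof.
  transitivity (sumL (leaves t) (fun pz => tprob t x y (fst pz) * 1));
    [apply sumL_ext; intros; ring|].
  induction t as [z|p t0 IH0 t1 IH1|q t0 IH0 t1 IH1].
  - cbn; ring.
  - rewrite (sumL_leaves_PA p t0 t1 x y (fun _ => 1)), IH0, IH1; ring.
  - rewrite (sumL_leaves_PB q t0 t1 x y (fun _ => 1)), IH0, IH1; ring.
Qed.

Lemma sumL_transcripts (P : rprot) (d : R * ptree) (h : R * ptree -> list bool -> R) :
  sumL (transcripts P) (fun tr => h (nth (fst tr) P d) (snd tr)) =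
  sumL P (fun wt => sumL (leaves (snd wt)) (fun pz => h wt (fst pz))).
Proof.
  unfold transcripts; rewrite sumL_flat_map.
  transitivity (sumL (indexed P) (fun iw => sumL (leaves (snd (snd iw)))
    (fun pz => h (nth (fst iw) P d) (fst pz)))).
  { apply sumL_ext; intros iw _; rewrite sumL_map; reflexivity. }
  (* The prefix [pre] makes the induction work: indices then start at its length. *)
  assert (G : forall (l pre : rprot) (F : R * ptree -> R * ptree -> R),
    sumL (combine (seq (length pre) (length l)) l)
      (fun iw => F (nth (fst iw) (pre ++ l) d) (snd iw)) = sumL l (fun wt => F wt wt)).
  { induction l as [|wt l IH]; intros pre F; [reflexivity|].
    cbn [length seq combine]; rewrite !sumL_cons; cbn [fst snd].
    rewrite nth_middle; f_equal.
    specialize (IH (pre ++ [wt]) F).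
    rewrite length_app, Nat.add_1_r, <- app_assoc in IH; exact IH. }
  exact (G P [] (fun wt wt' => sumL (leaves (snd wt')) (fun pz => h wt (fst pz)))).
Qed.

(** The inputs are independent and [v c b] cancels in the ratio, so the law of [a] given [b] and [c]
    depends on [c] alone. Summing over [b] leaves [dot lb q (v c)]; [ln 2] converts nats into
    bits. *)
Lemma cond_MI_product {C : Type} (la lb : list input) (lc : list C)
  (p q : input -> R) (u v : C -> input -> R) (J : input -> input -> C -> R) :
  (forall x, 0 <= p x) -> (forall c x, 0 <= u c x) -> mass la p = 1 ->
  (forall a b, In a la -> In b lb -> sumL lc (fun c => u c a * v c b) = 1) ->
  (forall a b c, J a b c = p a * q b * (u c a * v c b)) ->
  cond_MI la lb lc J = sumL lc (fun c => dot lb q (v c) * ent la p (u c)) / ln 2.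
Proof.
  intros Hp Hu HP Hch HJ.
  assert (Hpab : forall a b, In a la -> In b lb ->
    sumL lc (fun c => J a b c) = p a * q b).
  { intros a b Ha Hb; rewrite <- (Rmult_1_r (p a * q b)), <- (Hch a b Ha Hb), <- sumL_scal.
    apply sumL_ext; intros; apply HJ. }
  assert (Hpb : forall b, In b lb ->
    sumL la (fun a => sumL lc (fun c => J a b c)) = q b).
  { intros b Hb; transitivity (sumL la (fun a => p a * q b)).
    - apply sumL_ext; intros a Ha; apply Hpab; assumption.
    - rewrite sumL_scalr; fold (mass la p); rewrite HP; ring. }
  assert (Hpbc : forall b c, sumL la (fun a => J a b c) = q b * v c b * dot la p (u c)).
  { intros b c; unfold dot; rewrite <- sumL_scal; apply sumL_ext; intros; rewrite HJ; ring. }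
  unfold cond_MI; transitivity (sumL la (fun a => sumL lb (fun b => sumL lc (fun c =>
    p a * q b * (u c a * v c b) * (ln (u c a * mass la p / dot la p (u c)) / ln 2))))).
  - apply sumL_ext; intros a Ha; apply sumL_ext; intros b Hb; apply sumL_ext; intros c _.
    cbv zeta; rewrite Hpb, Hpab, Hpbc, HJ by assumption.
    destruct (Req_EM_T (p a * q b * (u c a * v c b)) 0) as [E|E].
    + rewrite E; ring.
    + f_equal; unfold log2; f_equal; f_equal; rewrite HP.
      assert (p a <> 0) by (intros Z; apply E; rewrite Z; ring).
      assert (q b <> 0) by (intros Z; apply E; rewrite Z; ring).
      assert (u c a <> 0) by (intros Z; apply E; rewrite Z; ring).
      assert (v c b <> 0) by (intros Z; apply E; rewrite Z; ring).
      pose proof (dot_ge_term la p (u c) a Hp (Hu c) Ha).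
      assert (0 < p a * u c a)
        by (apply Rmult_lt_0_compat; [pose proof (Hp a)|pose proof (Hu c a)]; lra).
      field; repeat split; try assumption; lra.
  - transitivity (sumL la (fun a => sumL lc (fun c => dot lb q (v c) *
      (p a * u c a * ln (u c a * mass la p / dot la p (u c))) / ln 2))).
    + apply sumL_ext; intros a _; rewrite sumL_swap; apply sumL_ext; intros c _.
      unfold dot at 2, Rdiv; rewrite <- !sumL_scalr.
      apply sumL_ext; intros b _; ring.
    + unfold ent, Rdiv; rewrite sumL_swap, <- sumL_scalr.
      apply sumL_ext; intros c _; rewrite sumL_scalr, sumL_scal; reflexivity.
Qed.

Definition protocol_channel (P : rprot) : list atom :=
  flat_map (fun wt => map (fun pz => Atom (snd pz)
      (fun x => fst wt * alice_prob (snd wt) x (fst pz))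
      (fun y => bob_prob (snd wt) y (fst pz))) (leaves (snd wt))) P.

Lemma protocol_channel_nonneg P : valid_rprot P -> nonneg_atoms (protocol_channel P).
Proof.
  intros [V _] t Ht; apply in_flat_map in Ht; destruct Ht as [wt [Hwt Ht]].
  apply in_map_iff in Ht; destruct Ht as [pz [<- _]]; destruct (V wt Hwt) as [W Vt]; cbn.
  split; intros u; destruct (ptree_prob_nonneg _ Vt u (fst pz));
    [apply Rmult_le_pos|]; assumption.
Qed.

Lemma protocol_channel_is_channel P X Y :
  valid_rprot P -> is_channel X Y (protocol_channel P).
Proof.
  intros [_ S] x y _ _; unfold protocol_channel; rewrite sumL_flat_map, <- S.
  apply sumL_ext; intros wt _; rewrite sumL_map; cbn [ux vy].
  transitivity (fst wt * sumL (leaves (snd wt)) (fun pz => tprob (snd wt) x y (fst pz)));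
    [|rewrite tprob_sum; ring].
  rewrite <- sumL_scal; apply sumL_ext; intros; rewrite tprob_factor; ring.
Qed.

Lemma protocol_channel_err n muX muY f P :
  channel_err (bits n) (bits n) muX muY f (protocol_channel P) =
  rerror n (fun x y => muX x * muY y) f P.
Proof.
  apply esum_ext; intros x y _ _; unfold out_prob, protocol_channel; rewrite sumL_flat_map.
  apply sumL_ext; intros wt _; rewrite sumL_map, <- sumL_scal; cbn [lab ux vy].
  apply sumL_ext; intros pz _; rewrite tprob_factor; unfold bool_err.
  destruct (snd pz), (f x y); cbn; ring.
Qed.

Lemma protocol_channel_info n muX muY P :
  is_dist1 n muX -> is_dist1 n muY -> valid_rprot P ->
  IC_mu n (fun x y => muX x * muY y) P =
  info (bits n) (bits n) muX muY (protocol_channel P) / ln 2.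
Proof.
  intros [HX SX] [HY SY] HV.
  set (node (c : nat * list bool) := nth (fst c) P (0, PLeaf false)).
  set (u c x := fst (node c) * alice_prob (snd (node c)) x (snd c)).
  set (v c y := bob_prob (snd (node c)) y (snd c)).
  (* The default has weight 0 and a valid tree, so this holds for indices out of range too. *)
  assert (Hnode : forall c, 0 <= fst (node c) /\ valid_ptree (snd (node c))).
  { intros c; unfold node; destruct (nth_in_or_default (fst c) P (0, PLeaf false)) as [H| ->].
    - apply HV; exact H.
    - cbn; split; [lra|exact I]. }
  assert (Hu : forall c x, 0 <= u c x).
  { intros c x; destruct (Hnode c) as [H1 H2]; apply Rmult_le_pos; [exact H1|].
    apply ptree_prob_nonneg; exact H2. }
  assert (Hv : forall c x, 0 <= v c x).
  { intros c x; destruct (Hnode c) as [H1 H2]; apply ptree_prob_nonneg; exact H2. }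
  assert (EX : mass (bits n : list input) muX = 1) by exact SX.
  assert (EY : mass (bits n : list input) muY = 1) by exact SY.
  assert (Hch : forall x y, sumL (transcripts P) (fun c => u c x * v c y) = 1).
  { intros x y; unfold u, v, node.
    rewrite (sumL_transcripts P _ (fun wt path =>
      fst wt * alice_prob (snd wt) x path * bob_prob (snd wt) y path)).
    rewrite <- (proj2 HV); apply sumL_ext; intros wt _.
    transitivity (fst wt * sumL (leaves (snd wt)) (fun pz => tprob (snd wt) x y (fst pz)));
      [|rewrite tprob_sum; ring].
    rewrite <- sumL_scal; apply sumL_ext; intros; rewrite tprob_factor; ring. }
  unfold IC_mu.
  rewrite (cond_MI_product (bits n) (bits n) _ muX muY u v),
    (cond_MI_product (bits n) (bits n) _ muY muX v u); try assumption.
  - unfold Rdiv; rewrite <- Rmult_plus_distr_r; f_equal; rewrite <- sumL_plus.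
    unfold info, protocol_channel; rewrite sumL_flat_map.
    etransitivity; [apply (sumL_transcripts P (0, PLeaf false) (fun wt path =>
      dot (bits n) muY (fun y => bob_prob (snd wt) y path) *
      ent (bits n) muX (fun x => fst wt * alice_prob (snd wt) x path) +
      dot (bits n) muX (fun x => fst wt * alice_prob (snd wt) x path) *
      ent (bits n) muY (fun y => bob_prob (snd wt) y path)))|].
    apply sumL_ext; intros wt _; rewrite sumL_map; reflexivity.
  - intros a b _ _; rewrite <- (Hch b a); apply sumL_ext; intros; ring.
  - intros a b c; unfold joint; rewrite tprob_factor; unfold u, v, node; ring.
  - intros a b _ _; apply Hch.
  - intros a b c; unfold joint; rewrite tprob_factor; unfold u, v, node; ring.
Qed.

(** Alice goes through [l] until she meets her input [a], then Bob announces [f a y]. This errorless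
    protocol shows that the infimum defining the information complexity is over a nonempty set. *)
Fixpoint reveal_tree (f : input -> input -> bool) (l : list input) : ptree :=
  match l with
  | [] => PLeaf false
  | a :: l' =>
      PA (fun x => if list_eq_dec bool_dec x a then 1 else 0) (reveal_tree f l')
        (PB (fun y => if f a y then 1 else 0) (PLeaf false) (PLeaf true))
  end.

Lemma reveal_tree_valid f l : valid_ptree (reveal_tree f l).
Proof.
  induction l as [|a l IH]; cbn; [exact I|]; repeat split; try exact IH;
    try (destruct (list_eq_dec bool_dec u a); lra); destruct (f a u); lra.
Qed.

Lemma reveal_tree_correct f l x y : In x l ->
  sumL (leaves (reveal_tree f l)) (fun pz =>
    tprob (reveal_tree f l) x y (fst pz) * bool_err (snd pz) (f x y)) = 0.
Proof.
  induction l as [|a l IH]; intros Hx; [easy|]; cbn [reveal_tree].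
  rewrite (sumL_leaves_PA _ _ _ x y (fun z => bool_err z (f x y))).
  rewrite (sumL_leaves_PB _ _ _ x y (fun z => bool_err z (f x y))).
  destruct (list_eq_dec bool_dec x a) as [->|N].
  - unfold sumL; cbn; destruct (f a y); cbn; ring.
  - rewrite IH; [ring|]; destruct Hx as [->|Hx]; [easy|exact Hx].
Qed.

Lemma exists_zero_error_protocol n mu f :
  exists P, valid_rprot P /\ rerror n mu f P = 0.
Proof.
  exists [(1, reveal_tree f (bits n))]; split.
  - split; [|cbn; ring].
    intros wt [<-|[]]; cbn; split; [lra|apply reveal_tree_valid].
  - unfold rerror; rewrite <- (sumL_0 (bits n)); apply sumL_ext; intros x Hx.
    rewrite <- (sumL_0 (bits n)); apply sumL_ext; intros y _.
    rewrite sumL_cons; cbn [fst snd]; rewrite reveal_tree_correct by exact Hx.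
    cbn; ring.
Qed.

Lemma exists_glb (S : R -> Prop) (m : R) :
  (exists s, S s) -> (forall s, S s -> m <= s) -> exists g, is_glb S g.
Proof.
  intros [s0 H0] Hm.
  destruct (completeness (fun v => S (- v))) as [g [Hub Hl]].
  - exists (- m); intros v Hv; specialize (Hm _ Hv); lra.
  - exists (- s0); rewrite Ropp_involutive; exact H0.
  - exists (- g); split.
    + intros s Hs; assert (- s <= g) by (apply Hub; rewrite Ropp_involutive; exact Hs); lra.
    + intros m' Hm'; assert (g <= - m'); [|lra].
      apply Hl; intros v Hv; specialize (Hm' _ Hv); lra.
Qed.

(** The infimum for this law exists, as information is nonnegative and an errorless protocol exists,
    and it is at most [I]. A protocol is only taken within 1 of the infimum, hence [I + 1]. *)
Lemma exists_protocol_of_IC n f muX muY I :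
  is_dist1 n muX -> is_dist1 n muY -> is_IC n (1 / 8) f I ->
  0 <= I /\ exists P, valid_rprot P /\
    rerror n (fun x y => muX x * muY y) f P <= 1 / 8 /\
    IC_mu n (fun x y => muX x * muY y) P <= I + 1.
Proof.
  intros HX HY [Hub _].
  set (mu x y := muX x * muY y) in *.
  set (S v := exists P, valid_rprot P /\ rerror n mu f P <= 1 / 8 /\ v = IC_mu n mu P).
  assert (Hpos : forall s, S s -> 0 <= s).
  { intros s [P [V [_ ->]]]; unfold mu; rewrite protocol_channel_info by assumption.
    apply Rle_mult_inv_pos; [|rewrite <- ln_1; apply ln_increasing; lra].
    apply info_nonneg; [apply protocol_channel_nonneg; exact V|apply HX|apply HY]. }
  assert (Hne : exists s, S s).
  { destruct (exists_zero_error_protocol n mu f) as [P [V E]].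
    exists (IC_mu n mu P), P; split; [exact V|split; [lra|reflexivity]]. }
  destruct (exists_glb S 0 Hne Hpos) as [g [Hg1 Hg2]].
  assert (HgI : g <= I).
  { apply Hub; exists mu; split; [|split; assumption].
    destruct HX as [PX SX], HY as [PY SY]; split.
    - intros; apply Rmult_le_pos; auto.
    - unfold mu; rewrite sumL_prod, SX, SY; ring. }
  split; [apply Rle_trans with g; [apply Hg2; exact Hpos|exact HgI]|].
  destruct (classic (exists s, S s /\ s < g + 1)) as [[s [[P [V [E ->]]] Hs]]|N].
  - exists P; split; [exact V|split; [exact E|lra]].
  - assert (g + 1 <= g); [|lra].
    apply Hg2; intros s Hs; destruct (Rle_lt_dec (g + 1) s); [assumption|].
    exfalso; apply N; exists s; split; assumption.
Qed.

(** Brings the quadratic bound into the form with logarithms. For [K <= 4] the constant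
    [36 = (4 + 2) ^ 2] suffices; beyond, [log2 K >= 2] and [K + 2 <= 2 * K]. *)
Lemma square_le_log_square (K : R) :
  0 <= K -> (K + 2) ^ 2 <= 36 * (K * log2 K) ^ 2 + 36.
Proof.
  intros HK; pose proof (pow2_ge_0 (K * log2 K)).
  destruct (Rle_lt_dec K 4) as [h|h]; [nra|].
  pose proof ln_lt_2 as l2.
  assert (2 <= log2 K).
  { apply Rmult_le_reg_r with (ln 2); [lra|].
    unfold log2; replace (ln K / ln 2 * ln 2) with (ln K) by (field; lra).
    replace (2 * ln 2) with (ln 4)
      by (replace 4 with (2 * 2) by ring; rewrite ln_mult by lra; ring).
    left; apply ln_increasing; lra. }
  assert (K * 2 <= K * log2 K) by (apply Rmult_le_compat_l; assumption).
  assert ((K * 2) ^ 2 <= (K * log2 K) ^ 2) by (apply pow_incr; lra).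
  nra.
Qed.

Theorem theorem1 :
  exists C : R, 0 < C /\
  forall (n : nat) (f : input -> input -> bool) (muX muY : input -> R),
    (1 <= n)%nat ->
    is_dist1 n muX -> is_dist1 n muY ->
    (forall I : R, is_IC n (1/8) f I ->
       CC_le n (fun x y => muX x * muY y) (49/100) f
         (C * (I * log2 I) ^ 2 + C)) /\
    (forall p : R, is_prt n (1/8) f p ->
       CC_le n (fun x y => muX x * muY y) (49/100) f
         (C * (log2 p * log2 (log2 p)) ^ 2 + C)).
Proof.
  destruct CC_le_of_channel as [C0 [HC0 core]].
  assert (l2 : 0 < ln 2 <= 1)
    by (split; [pose proof ln_lt_2|pose proof (ln_le_sub_1 2)]; lra).
  exists (36 * C0); split; [lra|]; intros n f muX muY _ HX HY.
  assert (Hfin : forall K, 0 <= K ->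
    C0 * (K + 2) ^ 2 <= 36 * C0 * (K * log2 K) ^ 2 + 36 * C0).
  { intros K HK; pose proof (square_le_log_square K HK) as H.
    apply (Rmult_le_compat_l C0) in H; lra. }
  split.
  - intros I HI.
    destruct (exists_protocol_of_IC n f muX muY I HX HY HI) as [HI0 [P [V [E B]]]].
    apply CC_le_mono with (C0 * (I + 1 + 1) ^ 2).
    { replace (I + 1 + 1) with (I + 2) by ring; auto. }
    apply core with (ts := protocol_channel P); try assumption; try lra.
    + apply protocol_channel_nonneg; exact V.
    + apply protocol_channel_is_channel; exact V.
    + rewrite protocol_channel_err; exact E.
    + rewrite protocol_channel_info in B by assumption.
      apply (Rmult_le_compat_r (ln 2)) in B; [|lra].
      unfold Rdiv in B; rewrite Rmult_assoc, Rinv_l in B by lra; nra.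
  - intros p [[w [Hw Ep]] _].
    pose proof (prt_obj_ge_1 n f w Hw) as Hp; rewrite Ep in Hp.
    assert (Hlnp : 0 <= ln p).
    { destruct Hp as [Hp|Hp]; [rewrite <- ln_1; left; apply ln_increasing; lra|].
      rewrite <- Hp, ln_1; lra. }
    assert (HK : 0 <= log2 p) by (apply Rle_mult_inv_pos; lra).
    apply CC_le_mono with (C0 * (log2 p + 1) ^ 2).
    { apply Rle_trans with (C0 * (log2 p + 2) ^ 2); [|auto].
      apply Rmult_le_compat_l; [lra|]; apply pow_incr; lra. }
    apply core with (ts := rect_channel n w); try assumption.
    + apply rect_channel_nonneg, Hw.
    + apply rect_channel_is_channel with f; exact Hw.
    + apply rect_channel_err; assumption.
    + apply Rle_trans with (ln p).
      * rewrite <- Ep; apply rect_channel_info with f; try assumption; lra.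
      (* [info] is measured in nats, and [ln 2 <= 1]. *)
      * replace (ln p) with (log2 p * ln 2) by (unfold log2; field; lra); nra.
Qed.
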